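(* For every $k\ge1$ there are $c,c'>0$ such that the following holds. For every $n\ge k$ and every pair of weighted hypergraphs $w,u:[n]^{(k)}\to\mathbb{R}$, we have $$\operatorname{disc}^+(w,u)\operatorname{disc}^-(w,u)\ge cn^{2k+1}\sum_{i=1}^k n^{-i}W_i^2U_i^2,$$ where $(W_0,\ldots,W_k)$ and $(U_0,\ldots,U_k)$ are the $W$-vectors of $w$ and $u$ respectively. In particular, $$\operatorname{disc}(w,u)\ge c'n^{k+1/2}\sum_{i=1}^kn^{-i/2}W_iU_i.$$
   Context: $[n]=\{1,\ldots,n\}$; $V^{(k)}$ is the family of $k$-subsets of $V$. A weighted $k$-uniform hypergraph on $V$ is a function $w:V^{(k)}\to\mathbb{R}$; $w(S)=\sum_{e\in S^{(k)}}w(e)$, $\langle w,u\rangle=\sum_{e\in V^{(k)}}w(e)u(e)$, $d(w)=w(V)/\binom{|V|}{k}$, and $w_\pi(e)=w(\pi^{-1}(e))$ for a permutation $\pi$ of $V$. With $n=|V|$: $\operatorname{disc}^+(w,u)=\max_\pi\langle w_\pi,u\rangle-d(w)d(u)\binom nk$, $\operatorname{disc}^-(w,u)=d(w)d(u)\binom nk-\min_\pi\langle w_\pi,u\rangle$, $\operatorname{disc}(w,u)=\max\{\operatorname{disc}^+,\operatorname{disc}^-\}$. $W$-vector (defined recursively on $k$): for a weighted $k$-uniform hypergraph $w$ on an $n$-set $V$, $W_0=|w(V)|/\binom nk$ (for $k=0$, $w$ is a single real number on the empty set and $W_0=|w|$). For $k\ge1$ and distinct $x,y\in V$, the difference weighting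 $w^{xy}:(V\setminus\{x,y\})^{(k-1)}\to\mathbb{R}$ is $w^{xy}(e)=w(e\cup\{x\})-w(e\cup\{y\})$; letting $(W^{xy}_0,\ldots,W^{xy}_{k-1})$ be its $W$-vector, define for $1\le i\le k$ $$W_i=\frac{1}{n(n-1)}\sum_{(x,y):\,x\ne y}W^{xy}_{i-1},$$ the average over ordered pairs of distinct vertices. The $W$-vector of $w$ is $(W_0,\ldots,W_k)$. *)

(* Defs.v *)
From HB Require Import structures.
From mathcomp Require Import all_boot all_order all_algebra all_fingroup.
From mathcomp Require Import reals.
Set Implicit Arguments. Unset Strict Implicit. Unset Printing Implicit Defensive.
Import Order.TTheory GRing.Theory Num.Theory.
Local Open Scope ring_scope.

Section Hyper.
Variable R : realType.

(* A weighted k-uniform hypergraph on a vertex set V (a subset of a finite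
   type T) is represented by w : {set T} -> R; only its values on the
   k-subsets of V are ever used. *)

Definition wsum (T : finType) (k : nat) (S : {set T}) (w : {set T} -> R) : R :=
  \sum_(e : {set T} | (e \subset S) && (#|e| == k)) w e.

Definition diffw (T : finType) (w : {set T} -> R) (x y : T) : {set T} -> R :=
  fun e => w (x |: e) - w (y |: e).

(* W-vector (W_0, ..., W_k) of a weighted k-uniform hypergraph w on V,
   as a function of the index i (meaningful for i <= k). *)
Fixpoint Wvec (T : finType) (k : nat) (V : {set T}) (w : {set T} -> R) (i : nat)
  {struct k} : R :=
  match i, k with
  | 0%N, _ => `|wsum k V w| / ('C(#|V|, k))%:R
  | i'.+1, 0%N => 0
  | i'.+1, k'.+1 =>
      (#|V| * (#|V|).-1)%:R^-1 *
      \sum_(x in V) \sum_(y in V | y != x) Wvec k' (V :\ x :\ y) (diffw w x y) i'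
  end.

Definition inner (n k : nat) (w u : {set 'I_n} -> R) : R :=
  \sum_(e : {set 'I_n} | #|e| == k) w e * u e.

Definition wperm (n : nat) (w : {set 'I_n} -> R) (p : {perm 'I_n}) : {set 'I_n} -> R :=
  fun e => w ((p^-1)%g @: e).

Definition dens (n k : nat) (w : {set 'I_n} -> R) : R :=
  wsum k [set: 'I_n] w / ('C(n, k))%:R.

(* max / min over all permutations (seeded with the identity permutation,
   which is itself one of the permutations, so these are exact max / min) *)
Definition maxperm (n k : nat) (w u : {set 'I_n} -> R) : R :=
  \big[Num.max/inner k w u]_(p : {perm 'I_n}) inner k (wperm w p) u.
Definition minperm (n k : nat) (w u : {set 'I_n} -> R) : R :=
  \big[Num.min/inner k w u]_(p : {perm 'I_n}) inner k (wperm w p) u.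

Definition discP (n k : nat) (w u : {set 'I_n} -> R) : R :=
  maxperm k w u - dens k w * dens k u * ('C(n, k))%:R.
Definition discM (n k : nat) (w u : {set 'I_n} -> R) : R :=
  dens k w * dens k u * ('C(n, k))%:R - minperm k w u.
Definition disc (n k : nat) (w u : {set 'I_n} -> R) : R :=
  Num.max (discP k w u) (discM k w u).

End Hyper.

(* Main.v *)
Require Import Defs.
From HB Require Import structures.
From mathcomp Require Import all_boot all_order all_algebra all_fingroup.
From mathcomp Require Import reals boolp zify ring lra.
Set Implicit Arguments. Unset Strict Implicit. Unset Printing Implicit Defensive.
Import Order.TTheory GRing.Theory Num.Theory.
Local Open Scope ring_scope.

(** For permutations [pi], [rho] of the vertex set, consider the pairing
    [<w_pi, u_rho>].  Composing [pi] with a subset of a fixed family of [m]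
    disjoint transpositions makes it a polynomial of degree at most [k] on the
    cube [{0,1}^m], and the increment along the transposition [(x y)] is the
    pairing of the difference weightings [w^{xy}] and [u^{xy}] of the relabelled
    hypergraphs.

    First step.  Starting from uniform [pi], [rho], perform with probability
    [t], independently, each of the disjoint transpositions that would alone
    increase the pairing.  The expectation is a polynomial in [t] of degree at
    most [k]; it starts at the mean, stays between the minimum and the maximum
    of the pairing, and its derivative at [0] is half the sum over the
    transpositions of the mean absolute increment.  Markov's inequality for
    the second derivative then gives
    [(derivative)^2 <= C disc^+ (disc^+ + disc^-)], and replacing [w] by [- w]
    exchanges the roles of [disc^+] and [disc^-], whence
    [disc^+ disc^- >= c n^2 (E |<w^{xy}, u^{xy}>|)^2].

    Further steps.  Bonami's inequality makes the [L^1] and [L^2] norms of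
    polynomials of degree at most [k] on the cube comparable, and the total
    [L^2] influence is at most [4 k] times the squared norm, so that
    [E |<w, u>| >= c n^{1/2} E |<w^{xy}, u^{xy}>|].  After [i] differences,
    averaging over the permutations of the remaining vertices replaces the
    pairing by a product of total weights, whose means are [W_i] and [U_i] up
    to binomial factors. *)

(** * Polynomials of bounded degree on the discrete cube *)

Section Cube.
Variable R : realType.
Implicit Types (f g : seq bool -> R) (m d : nat).

Definition face (b : bool) f : seq bool -> R := fun s => f (b :: s).

Fixpoint Ex m f : R :=
  if m is m'.+1 then (Ex m' (face false f) + Ex m' (face true f)) / 2 else f [::].

(* [f] is only meaningful on lists of length [m], read as points of the cube. *)
Fixpoint deg_le m d f : Prop :=
  if m is m'.+1 then
    deg_le m' d (face false f) /\
    (if d is d'.+1 then deg_le m' d' (fun s => face true f s - face false f s)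
     else forall s, face true f s = face false f s)
  else True.

Lemma deg_leS m d f : deg_le m d f -> deg_le m d.+1 f.
Proof.
elim: m d f => //= m IH [|d] f [h0 h1]; split; try exact: IH.
rewrite (_ : (fun s => _) = fun=> 0); first by elim: m {IH h0 h1} => //= m ?; split.
by apply/funext => s; rewrite h1 subrr.
Qed.

Lemma deg_le0 m d : deg_le m d (fun=> 0).
Proof.
elim: m d => //= m IH d; split; first exact: IH.
case: d => // d; rewrite (_ : (fun s => _) = fun=> 0); first exact: IH.
by apply/funext => s; rewrite /face subrr.
Qed.

Lemma deg_le_lin m d f g a :
  deg_le m d f -> deg_le m d g -> deg_le m d (fun s => f s + a * g s).
Proof.
elim: m d f g => //= m IH d f g [f0 f1] [g0 g1]; split; first exact: IH.
case: d f0 f1 g0 g1 => [|d] f0 f1 g0 g1; first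
  by move=> s; move: (f1 s) (g1 s); rewrite /face => -> ->.
rewrite (_ : (fun s => _) = fun s => (face true f s - face false f s) +
  a * (face true g s - face false g s)); first exact: IH.
by apply/funext => s; rewrite /face; ring.
Qed.

Lemma deg_le_sum (I : Type) (r : seq I) (P : pred I) m d (F : I -> seq bool -> R) :
  (forall i, P i -> deg_le m d (F i)) -> deg_le m d (fun s => \sum_(i <- r | P i) F i s).
Proof.
move=> h; elim: r => [|i r IH].
  rewrite (_ : (fun s => _) = fun=> 0); first exact: deg_le0.
  by apply/funext => s; rewrite big_nil.
rewrite (_ : (fun s => _) = fun s => \sum_(j <- r | P j) F j s + (P i)%:R * F i s); last first.
  by apply/funext => s; rewrite big_cons; case: ifP => _; rewrite ?mul1r ?mul0r ?addr0 // addrC.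
case: (boolP (P i)) => Pi; first by apply: deg_le_lin => //; exact: h.
rewrite (_ : (fun s => _) = fun s => \sum_(j <- r | P j) F j s) //.
by apply/funext => s; rewrite mul0r addr0.
Qed.

Lemma eq_Ex m f g : f =1 g -> Ex m f = Ex m g.
Proof. by move=> /funext ->. Qed.

Lemma ExD m f g : Ex m (fun s => f s + g s) = Ex m f + Ex m g.
Proof. by elim: m f g => //= m IH f g; rewrite /face !IH; field. Qed.

Lemma ExZ m a f : Ex m (fun s => a * f s) = a * Ex m f.
Proof. by elim: m f => //= m IH f; rewrite /face !IH; field. Qed.

Lemma le_Ex m f g : (forall s, f s <= g s) -> Ex m f <= Ex m g.
Proof.
elim: m f g => //= m IH f g h.
by rewrite ler_pM2r ?invr_gt0 ?ltr0n // lerD //; apply: IH => s; exact: h.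
Qed.

Lemma Ex_ge0 m f : (forall s, 0 <= f s) -> 0 <= Ex m f.
Proof.
elim: m f => //= m IH f h.
by rewrite divr_ge0 ?ler0n // addr_ge0 //; apply: IH => s; exact: h.
Qed.

Lemma Ex_eq0 m f : (forall s, f s = 0) -> Ex m f = 0.
Proof. by elim: m f => //= m IH f h; rewrite !IH ?addr0 ?mul0r // => s; exact: h. Qed.

(** The quadratic form [E (a f + b g)^2] is nonnegative; take [(a, b) = (X, - A)]. If [A = 0], then
    for [b = 1] it is affine in [a] with slope [2 X], which forces [X = 0]. *)
Lemma Ex_CS m f g :
  Ex m (fun s => f s * g s) ^+ 2 <= Ex m (fun s => f s ^+ 2) * Ex m (fun s => g s ^+ 2).
Proof.
set X := Ex m _; set A := Ex m _; set B := Ex m _.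
have q a b : 0 <= a ^+ 2 * A + 2 * a * b * X + b ^+ 2 * B.
  rewrite -!ExZ -!ExD; apply: Ex_ge0 => s.
  by rewrite (_ : _ + _ = (a * f s + b * g s) ^+ 2) ?sqr_ge0 //; ring.
have A0 : 0 <= A by apply: Ex_ge0 => s; exact: sqr_ge0.
have B0 : 0 <= B by apply: Ex_ge0 => s; exact: sqr_ge0.
have [A1|A1] := eqVneq A 0.
  have [->|X0] := eqVneq X 0; first by rewrite expr0n mulr_ge0.
  have := q (- (B + 1) / (2 * X)) 1; rewrite A1 mulr0 add0r mulr1 expr1n mul1r.
  rewrite (_ : 2 * _ * X = - (B + 1)); last by field.
  by move=> h; exfalso; lra.
have := q X (- A).
have Ap : 0 < A by rewrite lt_def A1.
rewrite (_ : _ + _ = A * (A * B - X ^+ 2)); last by ring.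
by rewrite pmulr_rge0 // subr_ge0.
Qed.

Lemma Ex_sqr m f : Ex m f ^+ 2 <= Ex m (fun s => f s ^+ 2).
Proof.
have := Ex_CS m f (fun=> 1); rewrite (@eq_Ex _ _ f); last by move=> s; rewrite mulr1.
rewrite (_ : Ex m (fun=> 1 ^+ 2) = 1) ?mulr1 //.
rewrite expr1n; elim: m => //= m IH.
by rewrite /face IH; field.
Qed.

(** * Hypercontractivity and comparison of norms *)

Definition favg f : seq bool -> R := fun s => (face false f s + face true f s) / 2.
Definition fdif f : seq bool -> R := fun s => (face false f s - face true f s) / 2.

Lemma faceF f s : face false f s = favg f s + fdif f s.
Proof. by rewrite /favg /fdif; field. Qed.
Lemma faceT f s : face true f s = favg f s - fdif f s.
Proof. by rewrite /favg /fdif; field. Qed.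

Lemma eq_ExS m f : Ex m.+1 f = Ex m (fun s => (f (false :: s) + f (true :: s)) / 2).
Proof. by rewrite /= mulrC -ExD -ExZ; apply: eq_Ex => s; rewrite /face mulrC. Qed.

Lemma Ex_sqrS m f :
  Ex m.+1 (fun s => f s ^+ 2) = Ex m (fun s => favg f s ^+ 2) + Ex m (fun s => fdif f s ^+ 2).
Proof. by rewrite eq_ExS -ExD; apply: eq_Ex => s; rewrite /favg /fdif /face; field. Qed.

Lemma deg_le_avg m d f : deg_le m.+1 d f -> deg_le m d (favg f).
Proof.
case=> f0 f1; case: d f0 f1 => [|d] f0 f1.
  by rewrite (_ : favg f = face false f) //; apply/funext => s; rewrite /favg f1; field.
rewrite (_ : favg f = fun s => face false f s + (1/2) * (face true f s - face false f s)).
  by apply: deg_le_lin => //; exact: deg_leS.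
by apply/funext => s; rewrite /favg; field.
Qed.

Lemma deg_le_dif m d f : deg_le m.+1 d.+1 f -> deg_le m d (fdif f).
Proof.
case=> f0 f1.
rewrite (_ : fdif f = fun s => 0 + (- (1/2)) * (face true f s - face false f s)).
  by apply: deg_le_lin => //; exact: deg_le0.
by apply/funext => s; rewrite /fdif; field.
Qed.

Lemma fdif_deg0 m f : deg_le m.+1 0 f -> forall s, fdif f s = 0.
Proof. by case=> _ h s; rewrite /fdif h subrr mul0r. Qed.

(** On its two faces [f] is [a + b] and [a - b], with [a] of degree [d] and [b] of degree [d - 1].
    Odd powers cancel, so [E f^4 = E a^4 + 6 E a^2 b^2 + E b^4]; the factor 9 that [b] saves pays
    for the mixed term, by Cauchy-Schwarz. *)
Lemma bonami m d f :
  deg_le m d f -> Ex m (fun s => f s ^+ 4) <= 9 ^+ d * Ex m (fun s => f s ^+ 2) ^+ 2.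
Proof.
elim: m d f => [|m IH] d f hf.
  rewrite /= -exprM ler_peMl ?exprn_even_ge0 // exprn_ege1 //; lra.
rewrite Ex_sqrS.
have -> : Ex m.+1 (fun s => f s ^+ 4) = Ex m (fun s => favg f s ^+ 4) +
    6 * Ex m (fun s => favg f s ^+ 2 * fdif f s ^+ 2) + Ex m (fun s => fdif f s ^+ 4).
  by rewrite eq_ExS -ExZ -!ExD; apply: eq_Ex => s; rewrite /favg /fdif /face; field.
have := Ex_CS m (fun s => favg f s ^+ 2) (fun s => fdif f s ^+ 2).
rewrite (@eq_Ex _ (fun s => (favg f s ^+ 2) ^+ 2) (fun s => favg f s ^+ 4)); last first.
  by move=> s; rewrite -exprM.
rewrite (@eq_Ex _ (fun s => (fdif f s ^+ 2) ^+ 2) (fun s => fdif f s ^+ 4)); last first.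
  by move=> s; rewrite -exprM.
have {IH} [IH0 IH1] := (IH d _ (deg_le_avg hf), IH d.-1 (fdif f)).
case: d hf IH0 IH1 => [|d] hf IH0 IH1.
  have z := fdif_deg0 hf.
  rewrite (@Ex_eq0 _ (fun s => favg f s ^+ 2 * _)) => [|s]; last by rewrite z expr0n mulr0.
  rewrite (@Ex_eq0 _ (fun s => fdif f s ^+ 4)) => [|s]; last by rewrite z expr0n.
  rewrite (@Ex_eq0 _ (fun s => fdif f s ^+ 2)) => [|s]; last by rewrite z expr0n.
  by rewrite !(mulr0, addr0) => _.
move: IH0 (IH1 (deg_le_dif hf)) => /=; rewrite exprS.
set A4 := Ex _ _; set A := Ex _ _; set B4 := Ex _ _; set B := Ex _ _.
set X := Ex _ _ => a4 b4 xx.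
have A0 : 0 <= A by apply: Ex_ge0 => s; exact: sqr_ge0.
have B0 : 0 <= B by apply: Ex_ge0 => s; exact: sqr_ge0.
have X0 : 0 <= X by apply: Ex_ge0 => s; rewrite mulr_ge0 // sqr_ge0.
have A40 : 0 <= A4 by apply: Ex_ge0 => s; rewrite exprn_even_ge0.
have B40 : 0 <= B4 by apply: Ex_ge0 => s; rewrite exprn_even_ge0.
move: a4 b4; set c : R := 9 ^+ d => a4 b4.
have c0 : 0 <= c by rewrite exprn_ge0.
have : X <= 3 * c * A * B.
  rewrite -(@ler_pXn2r _ 2) ?nnegrE ?mulr_ge0 //.
  apply: le_trans xx _; apply: le_trans (ler_pM _ _ a4 b4) _ => //.
  lra.
have : 0 <= c * B ^+ 2 by rewrite mulr_ge0 ?sqr_ge0.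
move: a4 b4; nra.
Qed.

(** Truncation: below a threshold [L] one has [f^2 <= L |f|], and by the fourth moment bound the
    values above [L] carry at most half of [E f^2]. *)
Lemma Ex_sqr_le_norm m d f : deg_le m d f ->
  Ex m (fun s => f s ^+ 2) <= 8 * 9 ^+ d * Ex m (fun s => `|f s|) ^+ 2.
Proof.
move=> /bonami; set A := Ex m (fun s => f s ^+ 2); set a := Ex m (fun s => `|f s|).
set c : R := 9 ^+ d; move=> h4.
have A0 : 0 <= A by apply: Ex_ge0 => s; exact: sqr_ge0.
have a0 : 0 <= a by apply: Ex_ge0.
have c0 : 0 < c by rewrite exprn_gt0.
have [->|A1] := eqVneq A 0; first by rewrite !mulr_ge0 ?sqr_ge0 // ltW.
have Ap : 0 < A by rewrite lt_def A1.
(* With this threshold [c * A ^+ 2] is half of [L ^+ 2 * A], so the fourth moment can be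
   absorbed. *)
pose L := Num.sqrt (2 * c * A).
have L2 : L ^+ 2 = 2 * c * A by rewrite sqr_sqrtr // !mulr_ge0 // ltW.
have Lp : 0 < L by rewrite sqrtr_gt0 !mulr_gt0.
(* Pointwise [L^2 y^2 <= L^3 y + y^4] for [y >= 0], by comparing [y] with [L]. *)
have key : L ^+ 2 * A <= L ^+ 3 * a + c * A ^+ 2.
  apply: le_trans (lerD (lexx _) h4); rewrite -!ExZ -ExD; apply: le_Ex => s.
  have -> : f s ^+ 4 = `|f s| ^+ 4 by rewrite -normrX ger0_norm // exprn_even_ge0.
  rewrite -(real_normK (num_real (f s))); set y := `|f s|.
  have y0 : 0 <= y by exact: normr_ge0.
  have [yL|Ly] := lerP y L.
    have : 0 <= L ^+ 2 * y * (L - y) + y ^+ 4.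
      by rewrite addr_ge0 ?exprn_ge0 // !mulr_ge0 ?subr_ge0 // ltW.
    lra.
  have : 0 <= y ^+ 2 * (y - L) * (y + L) + L ^+ 3 * y.
    by rewrite addr_ge0 ?mulr_ge0 ?subr_ge0 ?addr_ge0 ?exprn_ge0 // ltW.
  lra.
have le_A : A <= 2 * L * a.
  rewrite -(@ler_pM2l _ (c * A)) ?mulr_gt0 //.
  have L3 : L ^+ 3 = 2 * c * A * L by rewrite -L2; ring.
  by rewrite L3 L2 in key; lra.
rewrite -(@ler_pM2l _ A) //.
have : A ^+ 2 <= (2 * L * a) ^+ 2 by rewrite ler_pXn2r ?nnegrE // !mulr_ge0 // ltW.
have -> : (2 * L * a) ^+ 2 = 4 * (L ^+ 2) * a ^+ 2 by ring.
by rewrite L2; lra.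
Qed.

(** Total [L^1] influence: the sum over the coordinates of the mean absolute change of [f] along
    that coordinate. [infl2] is the same with squares. *)
Fixpoint infl1 m f : R :=
  if m is m'.+1 then Ex m' (fun s => `|face false f s - face true f s|) +
    (infl1 m' (face false f) + infl1 m' (face true f)) / 2 else 0.

Fixpoint infl2 m f : R :=
  if m is m'.+1 then Ex m' (fun s => (face false f s - face true f s) ^+ 2) +
    (infl2 m' (face false f) + infl2 m' (face true f)) / 2 else 0.

Lemma infl2_ge0 m f : 0 <= infl2 m f.
Proof.
elim: m f => //= m IH f; rewrite addr_ge0 ?divr_ge0 ?addr_ge0 ?IH //.
by apply: Ex_ge0 => s; exact: sqr_ge0.
Qed.

(** Cauchy-Schwarz over the [m] coordinates, peeled off one at a time. *)
Lemma infl1_sqr m f : infl1 m f ^+ 2 <= m%:R * infl2 m f.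
Proof.
elim: m f => [|m IH] f /=; first by rewrite expr0n mul0r.
set A := Ex _ _; set A2 := Ex _ _.
have hA : A ^+ 2 <= A2.
  apply: le_trans (Ex_sqr _ _) _; rewrite /A2 le_eqVlt; apply/orP; left; apply/eqP.
  by apply: eq_Ex => s; rewrite real_normK // num_real.
move: (IH (face false f)) (IH (face true f)) (infl2_ge0 m (face false f)) (infl2_ge0 m (face true
  f)).
set x := infl1 _ _; set y := infl1 _ _; set u := infl2 _ _; set v := infl2 _ _ => hx hy u0 v0.
have A20 : 0 <= A2 by apply: le_trans hA; exact: sqr_ge0.
rewrite -(natr1 m); set M : R := m%:R in hx hy *; have M0 : 0 <= M by exact: ler0n.
have [M1|M1] := eqVneq M 0.
  rewrite M1 mul0r in hx; rewrite M1 mul0r in hy.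
  have : x ^+ 2 == 0 by rewrite eq_le hx sqr_ge0.
  have : y ^+ 2 == 0 by rewrite eq_le hy sqr_ge0.
  by rewrite !sqrf_eq0 => /eqP -> /eqP ->; rewrite M1; lra.
have {M1} Mp : 0 < M by rewrite lt_def M1.
pose z := (x + y) / 2; pose w := (u + v) / 2.
have hz : z ^+ 2 <= M * w by have := sqr_ge0 (x - y); rewrite /z /w; lra.
rewrite -/z -/w -(@ler_pM2l _ M) //.
(* This square splits the cross term [2 M A z] with the right weights for one new coordinate against
   [M] old ones. *)
have := sqr_ge0 (M * A - z); have := ler_wpM2l M0 hz.
by have := ler_wpM2l (addr_ge0 M0 (mulr_ge0 M0 M0)) hA; lra.
Qed.

(** [infl2] is a quadratic form. For [favg] and [fdif] the left side is the sum over the two faces,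
    so the parts of different degree separate. *)
Lemma infl2_parallelogram m f g :
  infl2 m (fun s => f s + g s) + infl2 m (fun s => f s - g s) = 2 * (infl2 m f + infl2 m g).
Proof.
elim: m f g => [|m IH] f g /=; first by ring.
have := IH (face false f) (face false g); have := IH (face true f) (face true g).
rewrite /face => h1 h2.
have : Ex m (fun s => (f (false :: s) + g (false :: s) - (f (true :: s) + g (true :: s))) ^+ 2) +
  Ex m (fun s => (f (false :: s) - g (false :: s) - (f (true :: s) - g (true :: s))) ^+ 2) =
  2 * (Ex m (fun s => (f (false :: s) - f (true :: s)) ^+ 2) +
       Ex m (fun s => (g (false :: s) - g (true :: s)) ^+ 2)).
  by rewrite -!ExD -ExZ; apply: eq_Ex => s; ring.
by move: h1 h2; lra.
Qed.

Lemma infl2_0 m f : (forall s, f s = 0) -> infl2 m f = 0.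
Proof.
elim: m f => //= m IH f h; rewrite !IH => [|s|s]; try exact: h.
rewrite Ex_eq0 => [|s]; first by rewrite !(addr0, mul0r).
by rewrite /face !h subrr expr0n.
Qed.

(** In Fourier terms [infl2] weights the squared coefficient at a set [S] by [4 #|S|]. In the
    induction the first coordinate adds four times the second moment of [fdif f], which is what
    [fdif f] saves by having lower degree. *)
Lemma infl2_le m d f : deg_le m d f -> infl2 m f <= 4 * d%:R * Ex m (fun s => f s ^+ 2).
Proof.
elim: m d f => [|m IH] d f hf; first by rewrite /= mulr_ge0 ?sqr_ge0 // mulr_ge0 ?ler0n.
rewrite Ex_sqrS /=.
have -> : face false f = fun s => favg f s + fdif f s by apply/funext => s; rewrite faceF.
have -> : face true f = fun s => favg f s - fdif f s by apply/funext => s; rewrite faceT.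
rewrite infl2_parallelogram [2 * _ / _]mulrAC divff ?mul1r ?pnatr_eq0 //.
rewrite (@eq_Ex _ _ (fun s => 4 * fdif f s ^+ 2)) => [|s]; last by ring.
rewrite ExZ; have IH0 := IH d _ (deg_le_avg hf).
have B0 : 0 <= Ex m (fun s => fdif f s ^+ 2) by apply: Ex_ge0 => s; exact: sqr_ge0.
case: d hf IH0 => [|d] hf IH0.
  rewrite (@Ex_eq0 _ (fun s => fdif f s ^+ 2)) => [|s]; last first.
    by rewrite (fdif_deg0 hf) expr0n.
  have z : infl2 m (fdif f) = 0 by apply: infl2_0; exact: (fdif_deg0 hf).
  by rewrite z; move: IH0; rewrite !mulr0 !mul0r => IH0; rewrite add0r addr0.
have := IH d _ (deg_le_dif hf); rewrite -(natr1 d) in IH0 *; move: IH0 B0; nra.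
Qed.

(** The constant [32] is the product of the [4] of [infl2_le] and the [8] of [Ex_sqr_le_norm]. *)
Lemma infl1_le m d f : deg_le m d f ->
  infl1 m f <= Num.sqrt (32 * d%:R * 9 ^+ d * m%:R) * Ex m (fun s => `|f s|).
Proof.
move=> hf; have h1 := infl1_sqr m f; have h2 := infl2_le hf; have h3 := Ex_sqr_le_norm hf.
have a0 : 0 <= Ex m (fun s => `|f s|) by apply: Ex_ge0.
apply: le_trans (ler_norm _) _; rewrite -sqrtr_sqr -[leRHS]ger0_norm ?mulr_ge0 ?sqrtr_ge0 //.
rewrite -[leRHS]sqrtr_sqr ler_sqrt ?sqr_ge0 // exprMn sqr_sqrtr ?mulr_ge0 ?exprn_ge0 //.
apply: le_trans h1 _; apply: le_trans (ler_wpM2l (ler0n _ _) h2) _.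
apply: le_trans (ler_wpM2l (ler0n _ _) (ler_wpM2l _ h3)) _; first by rewrite mulr_ge0.
lra.
Qed.

End Cube.

(** * Polynomials bounded on the unit interval *)

Section Poly.
Variable R : realType.
Implicit Types (p q : {poly R}).

(* [2 ^ (d + 1) p(t / 2) - p(t)] has no term of degree [d + 1] and its other
   coefficients dominate those of [p]. *)
Lemma coef_bound (d : nat) : exists2 C : R, 0 <= C & forall p (B : R),
  (size p <= d.+1)%N -> (forall t : R, 0 <= t <= 1 -> `|p.[t]| <= B) ->
  forall j, `|p`_j| <= C * B.
Proof.
elim: d => [|d [C C0 IH]].
  exists 1 => // p B /size1_polyC -> h j; rewrite mul1r coefC.
  have := h 0; rewrite lexx ler01 hornerC => /(_ isT) hB.
  by case: eqP => // _; rewrite normr0; apply: le_trans hB.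
pose c : R := 2 ^+ d.+1; pose C1 := C * (c + 1).
have c1 : 1 <= c by apply: exprn_ege1; lra.
have C10 : 0 <= C1 by rewrite mulr_ge0 //; lra.
exists (1 + d.+2%:R * C1); first exact: addr_ge0 ler01 (mulr_ge0 (ler0n _ _) C10).
move=> p B sp h.
have B0 : 0 <= B by apply: le_trans (normr_ge0 _) (h 0 _); rewrite lexx ler01.
pose q := \poly_(i < d.+1) (p`_i * (c * 2^-1 ^+ i - 1)).
have hq t : q.[t] = c * p.[t / 2] - p.[t].
  rewrite horner_poly !(horner_coef_wide _ sp) mulr_sumr -sumrB [RHS]big_ord_recr /=.
  rewrite [X in _ = _ + X](_ : _ = 0); first rewrite addr0.
    by apply: eq_bigr => i _; rewrite exprMn; ring.
  rewrite exprMn exprVn /c; field.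
  by rewrite expf_neq0 // pnatr_eq0.
have low j : (j < d.+1)%N -> `|p`_j| <= C1 * B.
  move=> jd; have : `|q`_j| <= C * ((c + 1) * B).
    apply: IH; first exact: size_poly.
    move=> t /andP[t0 t1]; rewrite hq; apply: le_trans (ler_normB _ _) _.
    rewrite normrM (ger0_norm (ltW _)) ?(lt_le_trans _ c1) // mulrDl mul1r.
    rewrite lerD ?ler_wpM2l ?h ?t0 ?t1 //; first by lra.
    by apply/andP; lra.
  rewrite coef_poly jd normrM mulrA; apply: le_trans; rewrite ler_peMr //.
  apply: le_trans (ler_norm _); rewrite lerBrDr.
  rewrite exprVn -expfB // /c -[1 + 1]/(2 ^+ 1).
  by rewrite ler_eXn2l ?subn_gt0 //; lra.
(* The top coefficient is what remains of [p(1)] after removing the lower ones. *)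
have top : `|p`_d.+1| <= B + d.+1%:R * (C1 * B).
  have := h 1; rewrite lexx ler01 (horner_coef_wide _ sp) big_ord_recr /= => /(_ isT).
  set S := \sum_(i < _) _; rewrite expr1n mulr1 => hS.
  have : `|S| <= d.+1%:R * (C1 * B).
    apply: le_trans (ler_norm_sum _ _ _) _.
    have -> : d.+1%:R * (C1 * B) = \sum_(i < d.+1) (C1 * B).
      by rewrite sumr_const card_ord mulr_natl.
    by apply: ler_sum => i _; rewrite expr1n mulr1 low.
  have := ler_normB (S + p`_d.+1) S; rewrite addrC addKr; lra.
have CB : 0 <= C1 * B by rewrite mulr_ge0.
move=> j; rewrite mulrDl mul1r -mulrA -(natr1 d.+1) mulrDl mul1r.
have dC : 0 <= d.+1%:R * (C1 * B) by rewrite mulr_ge0.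
case: (ltngtP j d.+1) => [jd|jd|->]; last by lra.
  by have := low j jd; lra.
by rewrite nth_default ?normr0 ?(leq_trans sp) //; lra.
Qed.

Lemma coef1_bound (d : nat) : exists2 C : R, 0 <= C & forall q (lo hi : R),
  (size q <= d.+1)%N -> (forall t : R, 0 <= t <= 1 -> lo <= q.[t] <= hi) ->
  0 <= q`_1 -> q`_1 ^+ 2 <= C * ((hi - q`_0) * (hi - lo)).
Proof.
have [C C0 hC] := coef_bound d.
exists (4 * (d.+1%:R * C)); first by rewrite mulr_ge0 // mulr_ge0.
move=> q lo hi sq hq a0; set a := q`_1 in a0 *.
pose Q := hi%:P - q; pose B := hi - lo.
have sQ : (size Q <= d.+1)%N.
  by apply: leq_trans (size_polyD _ _) _; rewrite size_polyN geq_max sq (leq_trans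
    (size_polyC_leq1 _)).
have hQ t : 0 <= t <= 1 -> 0 <= Q.[t] <= B.
  by move=> /hq; rewrite hornerD hornerN hornerC /B => /andP[? ?]; apply/andP; lra.
have cQ j : `|Q`_j| <= C * B.
  by apply: hC sQ _ j => t /hQ /andP[? ?]; rewrite ger0_norm.
have B0 : 0 <= B by have /andP[x y] := hQ 0 (introT andP (conj (lexx _) ler01)); exact: le_trans y.
have CB : 0 <= C * B by rewrite mulr_ge0.
(* There are at most [d] terms of degree two or more; the extra summand ensures [a <= D], also for
   [d = 0]. *)
pose D := d.+1%:R * (C * B).
have CD : C * B <= D by rewrite /D ler_peMl // ler1n.
have aD : a <= D.
  have := cQ 1%N; rewrite coefB coefC /= sub0r normrN => h.
  by apply: le_trans CD; apply: le_trans h; exact: ler_norm.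
have key t : 0 <= t <= 1 -> a * t <= hi - q`_0 + D * t ^+ 2.
  move=> t01; have /andP[t0 t1] := t01; have /andP[Qt _] := hQ t t01; move: Qt.
  have sQ2 : (size Q <= d.+2)%N by apply: leq_trans sQ _.
  rewrite (horner_coef_wide _ sQ2) !big_ord_recl; set S := \sum_(i < _) _.
  rewrite expr0 expr1 mulr1 !coefB !coefC /= sub0r.
  suff : S <= D * t ^+ 2 by rewrite -/a; lra.
  have : S <= \sum_(i < d) (C * B * t ^+ 2).
    apply: ler_sum => i _; apply: le_trans (ler_norm _) _; rewrite normrM ler_pM //.
    by rewrite normrX ger0_norm // ler_wiXn2l.
  rewrite sumr_const card_ord /D -mulr_natl -(natr1 d) => /le_trans; apply.
  by have := mulr_ge0 CB (sqr_ge0 t); lra.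
have [D0|D0] := eqVneq D 0.
  have -> : a = 0 by apply/eqP; rewrite eq_le a0 -[X in _ <= X]D0 aD.
  rewrite expr0n mulr_ge0 // ?mulr_ge0 //; have := key 0; rewrite lexx ler01 => /(_ isT); lra.
have Dp : 0 < D by rewrite lt_def D0; apply: le_trans a0 aD.
have D2 : 0 < 2 * D by rewrite mulr_gt0.
(* The maximum of [a t - D t^2], attained inside the unit interval because [a <= D]. *)
have h : a * (a / (2 * D)) <= hi - q`_0 + D * (a / (2 * D)) ^+ 2.
  by apply: key; rewrite divr_ge0 ?(ltW D2) // ler_pdivrMr // mul1r; lra.
have -> : 4 * (d.+1%:R * C) * ((hi - q`_0) * (hi - lo)) = 4 * D * (hi - q`_0).
  by rewrite /D /B; ring.
have {h} : 0 <= 4 * D * (hi - q`_0 + D * (a / (2 * D)) ^+ 2 - a * (a / (2 * D))).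
  by rewrite mulr_ge0 ?mulr_ge0 ?(ltW Dp) // subr_ge0.
rewrite (_ : 4 * D * _ = 4 * D * (hi - q`_0) - a ^+ 2); first by lra.
by field.
Qed.
End Poly.

(** * Disjoint transpositions as a cube *)

Section Bias.
Variable R : realType.
Implicit Types f g : seq bool -> R.

(* The expectation of [f] when each flagged coordinate is set to [true]
   independently with probability ['X] and all others are [false]. *)
Fixpoint bias (fl : seq bool) f : {poly R} :=
  if fl is b :: fl' then
    bias fl' (face false f) +
    (if b then 'X * (bias fl' (face true f) - bias fl' (face false f)) else 0)
  else (f [::])%:P.

Lemma biasB fl f g : bias fl (fun s => f s - g s) = bias fl f - bias fl g.
Proof.
elim: fl f g => [|b fl IH] f g /=; first by rewrite polyCB.
by rewrite /face !IH; case: b; ring.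
Qed.

Lemma bias_0 fl f : (forall s, f s = 0) -> bias fl f = 0.
Proof.
elim: fl f => [|b fl IH] f h /=; first by rewrite h.
by rewrite !IH ?subrr ?mulr0 ?if_same ?addr0 // => s; exact: h.
Qed.

(** Every factor ['X] comes with a difference of two faces, which lowers the degree by one. *)
Lemma size_bias fl d f : deg_le (size fl) d f -> (size (bias fl f) <= d.+1)%N.
Proof.
elim: fl d f => [|b fl IH] d f; first by move=> _; rewrite (leq_trans (size_polyC_leq1 _)).
case=> h0 h1; rewrite /= -biasB; apply: leq_trans (size_polyD _ _) _.
rewrite geq_max IH //=; case: b; last by rewrite size_poly0.
case: d {h0} h1 => [|d] h1; last first.
  by apply: leq_trans (size_polyMleq _ _) _; rewrite size_polyX /= ltnS IH.
by rewrite bias_0 ?mulr0 ?size_poly0 // => s; rewrite h1 subrr.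
Qed.

Lemma bias_bound fl f (lo hi t : R) :
  (forall s, lo <= f s <= hi) -> 0 <= t <= 1 -> lo <= (bias fl f).[t] <= hi.
Proof.
move=> + t01; have /andP[t0 t1] := t01.
elim: fl f => [|b fl IH] f h /=; first by rewrite hornerC.
have /andP[a0 a1] := IH (face false f) (fun s => h _).
have /andP[b0 b1] := IH (face true f) (fun s => h _).
rewrite hornerD; case: b; last by rewrite horner0 addr0 a0.
rewrite hornerM hornerX hornerD hornerN; apply/andP; split; nra.
Qed.

End Bias.

Section Swaps.
Variables (R : realType) (T : finType).
Implicit Types (l h : seq (T * T)) (Phi : {perm T} -> R) (p q : T * T) (s : seq bool) (w : {set
  T} -> R).

Definition swap p : {perm T} := tperm p.1 p.2.

(** [uniq (flat l)] states at once that each pair has distinct entries and that the pairs are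
    disjoint. *)
Definition flat l : seq T := flatten [seq [:: p.1; p.2] | p <- l].

Fixpoint swaps l s : {perm T} :=
  match l, s with
  | p :: l', b :: s' => if b then swap p * swaps l' s' else swaps l' s'
  | _, _ => 1
  end%g.

(** Permutations compose from left to right: the transpositions act before [pi], hence on fixed
    vertices, while [pi] relabels. *)
Definition cube l Phi pi s : R := Phi (swaps l s * pi)%g.

Lemma cubeT p l Phi pi :
  face true (cube (p :: l) Phi pi) = cube l (fun z => Phi (swap p * z)%g) pi.
Proof. by apply/funext => s; rewrite /face /cube /= mulgA. Qed.

Lemma cubeF p l Phi pi : face false (cube (p :: l) Phi pi) = cube l Phi pi.
Proof. by []. Qed.

Lemma bias_cube0 (c : pred (T * T)) l Phi pi :
  (bias [seq c p | p <- l] (cube l Phi pi))`_0 = Phi pi.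
Proof.
elim: l Phi => [|p l IH] Phi /=; first by rewrite coefC /cube /= mul1g.
by rewrite cubeF coefD IH; case: (c p); rewrite ?coefXM ?coef0 addr0.
Qed.

(** To first order in the probability, at most one transposition is performed. *)
Lemma bias_cube1 (c : pred (T * T)) l Phi pi :
  (bias [seq c p | p <- l] (cube l Phi pi))`_1 =
  \sum_(p <- l) (c p)%:R * (Phi (swap p * pi)%g - Phi pi).
Proof.
elim: l => [|p l IH] /=; first by rewrite coefC big_nil.
rewrite cubeF cubeT coefD IH big_cons addrC; congr (_ + _).
by case: (c p); rewrite ?coef0 ?mul0r // mul1r coefXM /= coefB !bias_cube0.
Qed.

(** Left multiplication by a transposition permutes the group, so each point of the cube contributes
    the full sum of [Phi]. *)
Lemma sum_Ex_cube l Phi :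
  \sum_pi Ex (size l) (cube l Phi pi) = \sum_pi Phi pi.
Proof.
elim: l Phi => [|p l IH] Phi; first by apply: eq_bigr => pi _; rewrite /= /cube mul1g.
rewrite /=; under eq_bigr do rewrite cubeT cubeF.
rewrite -mulr_suml big_split /= !IH.
rewrite (reindex_inj (mulgI (swap p)) (F := Phi)) /=; by field.
Qed.

Lemma swap_fix p x : x \notin [:: p.1; p.2] -> swap p x = x.
Proof.
rewrite !inE negb_or => /andP[h1 h2].
by rewrite /swap tpermD // eq_sym.
Qed.

Lemma swapC p q : uniq (flat [:: p; q]) -> commute (swap p) (swap q).
Proof.
rewrite /= !inE !negb_or => /andP[/and3P[_ h1 h2] /andP[/andP[h3 h4] _]].
apply/commgP/conjg_fixP; rewrite /swap tpermJ !tpermD //; by rewrite eq_sym.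
Qed.

Lemma uniq_flat_cons p l : uniq (flat (p :: l)) ->
  [/\ p.1 != p.2, p.1 \notin flat l, p.2 \notin flat l & uniq (flat l)].
Proof. by rewrite /= inE negb_or => /and3P[/andP[-> ->] -> ->]. Qed.

Lemma flat_cons p l : flat (p :: l) = p.1 :: p.2 :: flat l.
Proof. by []. Qed.

Lemma flat_cat l h : flat (l ++ h) = flat l ++ flat h.
Proof. by rewrite /flat map_cat flatten_cat. Qed.

Lemma mem_flat p l : p \in l -> (p.1 \in flat l) && (p.2 \in flat l).
Proof.
elim: l => // q l IH; rewrite inE flat_cons !inE => /orP[/eqP->|/IH/andP[-> ->]].
  by rewrite !eqxx !orbT.
by rewrite !orbT.
Qed.

Lemma uniq_flat_mem l p : uniq (flat l) -> p \in l -> p.1 != p.2.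
Proof.
elim: l => // q l IH /uniq_flat_cons[q12 _ _ ul]; rewrite inE => /orP[/eqP-> //|].
exact: IH.
Qed.

Lemma sum_infl1_cube l Phi : uniq (flat l) ->
  \sum_pi infl1 (size l) (cube l Phi pi) =
  \sum_(p <- l) \sum_pi `|Phi pi - Phi (swap p * pi)%g|.
Proof.
elim: l Phi => [|p l IH] Phi ul; first by rewrite big_nil big1.
have [p12 p1 p2 ul'] := uniq_flat_cons ul.
rewrite big_cons /=; under eq_bigr do rewrite cubeT cubeF.
rewrite big_split /= -mulr_suml big_split /= !IH //; congr (_ + _).
  rewrite -(sum_Ex_cube l (fun z => `|Phi z - Phi (swap p * z)%g|)).
  by apply: eq_bigr.
(* On the [true] face [Phi] is composed with [swap p]; it commutes with the other transpositions, so
   a change of variables removes it. *)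
have -> : \sum_(q <- l) \sum_pi `|Phi (swap p * pi)%g - Phi (swap p * (swap q * pi))%g| =
   \sum_(q <- l) \sum_pi `|Phi pi - Phi (swap q * pi)%g|; last by field.
rewrite !big_seq; apply: eq_bigr => q ql; have /andP[q1 q2] := mem_flat ql.
have q12 := uniq_flat_mem ul' ql.
rewrite [RHS](reindex_inj (mulgI (swap p))) /=; apply: eq_bigr => pi _.
rewrite !mulgA (swapC (p := p) (q := q)) // flat_cons /= !inE !negb_or p12 /= andbT.
by rewrite q12 !(eq_sym p.1) !(eq_sym p.2) (memPn p1 _ q1) (memPn p1 _ q2) (memPn p2 _ q1) (memPn
  p2 _ q2).
Qed.

Lemma swaps_fix l s x : x \notin flat l -> swaps l s x = x.
Proof.
elim: l s => [|p l IH] [|b s] //=; rewrite ?perm1 // !inE !negb_or => /and3P[h1 h2 h3].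
case: b; rewrite ?permM ?swap_fix ?IH // !inE negb_or h1; exact: h2.
Qed.

Lemma imset_permM (s t : {perm T}) (e : {set T}) : (s * t)%g @: e = t @: (s @: e).
Proof. by rewrite -imset_comp; apply: eq_imset => x; rewrite /= permM. Qed.

Lemma imset_fix (s : {perm T}) (e : {set T}) : {in e, forall x, s x = x} -> s @: e = e.
Proof. by move=> h; rewrite (eq_in_imset h) imset_id. Qed.

Lemma deg_le_leq m d d' (f : seq bool -> R) : (d <= d')%N -> deg_le m d f -> deg_le m d' f.
Proof.
move=> /subnKC <- hf; elim: (d' - d)%N => [|n IH]; first by rewrite addn0.
by rewrite addnS; exact: deg_leS.
Qed.

(** A pair that misses [e] has no effect. A pair that meets [e] uses up a vertex of [e], and its
    increment involves only later pairs; hence the degree is at most the number of vertices of [e]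
    in the pairs. *)
Lemma deg_le_swaps l (phi : {set T} -> R) (e : {set T}) : uniq (flat l) ->
  deg_le (size l) #|[set x in e | x \in flat l]| (fun s => phi (swaps l s @: e)).
Proof.
elim: l e => //= p l IH e ul; have [p12 p1 p2 ul'] := uniq_flat_cons ul.
have sub : [set x in e | x \in flat l] \subset [set x in e | x \in flat (p :: l)].
  by apply/subsetP => x; rewrite !inE => /andP[-> ->]; rewrite !orbT.
split; first by apply: deg_le_leq (subset_leq_card sub) _; exact: IH.
rewrite (_ : face true _ = fun s => phi (swaps l s @: (swap p @: e))); last first.
  by apply/funext => s; rewrite /face /= imset_permM.
rewrite (_ : face false _ = fun s => phi (swaps l s @: e)) //.
have [meet|nomeet] := boolP ((p.1 \in e) || (p.2 \in e)); last first.
  have -> : swap p @: e = e.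
    apply: imset_fix => x xe; apply: swap_fix; rewrite !inE.
    by apply: contra nomeet => /orP[] /eqP <-; rewrite xe ?orbT.
  case: #|_| => [|d] //; rewrite (_ : (fun s => _) = fun=> 0); first exact: deg_le0.
  by apply/funext => s; rewrite subrr.
have : (#|[set x in e | x \in flat l]| < #|[set x in e | x \in flat (p :: l)]|)%N.
  apply: proper_card; rewrite properE sub; apply/subsetPn.
  by case/orP: meet => pe; [exists p.1|exists p.2]; rewrite !inE ?pe ?eqxx ?orbT ?(negbTE p1)
    ?(negbTE p2).
case: #|[set x in e | x \in flat (p :: l)]| => // d; rewrite ltnS => cd.
have -> : (fun s => phi (swaps l s @: (swap p @: e)) - phi (swaps l s @: e)) =
  fun s => phi (swaps l s @: (swap p @: e)) + (-1) * phi (swaps l s @: e).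
  by apply/funext => s; rewrite mulN1r.
apply: deg_le_lin; apply: deg_le_leq cd _; last exact: IH.
have -> : [set x in e | x \in flat l] = [set x in swap p @: e | x \in flat l]; last exact: IH.
apply/setP => x; rewrite !inE; case xl : (x \in flat l); rewrite ?andbF // !andbT.
rewrite -[x in RHS](_ : swap p x = x) ?mem_imset //; first exact: perm_inj.
by apply: swap_fix; rewrite !inE; apply/negP => /orP[] /eqP E'; move: p1 p2; rewrite -E' xl.
Qed.

End Swaps.

(** * Iterated difference weightings and W-vectors *)

Section Relabel.
Variables (R : realType) (T : finType).
Implicit Types (l h : seq (T * T)) (p q : T * T) (w u phi gam : {set T} -> R)
  (V A B e : {set T}) (s t : {perm T}).

(** Relabelling without an inverse: [wperm w p] is [pull w p^-1]. *)
Definition pull w s : {set T} -> R := fun e => w (s @: e).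

Definition hmap s h := [seq (s p.1, s p.2) | p <- h].

Definition diffs h w := foldl (fun w p => diffw w p.1 p.2) w h.

Definition rest h : {set T} := [set x | x \notin flat h].

Lemma pullM w s t : pull (pull w s) t = pull w (t * s)%g.
Proof. by apply/funext => e; rewrite /pull imset_permM. Qed.

Lemma diffw_pull w s x y : diffw (pull w s) x y = pull (diffw w (s x) (s y)) s.
Proof. by apply/funext => e; rewrite /diffw /pull !imsetU1. Qed.

Lemma diffs_pull h w s : diffs h (pull w s) = pull (diffs (hmap s h) w) s.
Proof. by elim: h w => //= p h IH w; rewrite diffw_pull IH. Qed.

Lemma diffs_rcons h p w : diffs (rcons h p) w = diffw (diffs h w) p.1 p.2.
Proof. by rewrite /diffs foldl_rcons. Qed.

Lemma flat_hmap s h : flat (hmap s h) = map s (flat h).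
Proof. by elim: h => //= p h; rewrite /flat /= => ->. Qed.

Lemma hmap_id s h : {in flat h, forall x, s x = x} -> hmap s h = h.
Proof.
elim: h => //= -[a b] h IH fx; rewrite /= !fx ?flat_cons ?inE ?eqxx ?orbT // IH //.
by move=> x xh; apply: fx; rewrite flat_cons !inE xh !orbT.
Qed.

Lemma flat_rcons h p : flat (rcons h p) = flat h ++ [:: p.1; p.2].
Proof. by rewrite -cats1 flat_cat. Qed.

Lemma rest_rcons h p : rest (rcons h p) = rest h :\ p.1 :\ p.2.
Proof.
apply/setP => x; rewrite !inE flat_rcons mem_cat !inE !negb_or.
by rewrite andbC -andbA andbCA andbA.
Qed.

Lemma rest_hmap s h : rest (hmap s h) = s @: rest h.
Proof.
apply/setP => x; rewrite -[x](permKV s) mem_imset; last exact: perm_inj.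
by rewrite !inE flat_hmap mem_map //; exact: perm_inj.
Qed.

Lemma card_rest h : uniq (flat h) -> #|rest h| = (#|T| - 2 * size h)%N.
Proof.
move=> uh; have -> : rest h = ~: [set x in flat h] by apply/setP => x; rewrite !inE.
rewrite cardsCs setCK cardsE (card_uniqP uh).
by congr (_ - _)%N; elim: h {uh} => //= p h; rewrite /flat /= => ->; rewrite mulnS.
Qed.

Lemma uniq_flat_rcons h p :
  uniq (flat (rcons h p)) = [&& uniq (flat h), p.1 \in rest h, p.2 \in rest h & p.1 != p.2].
Proof.
rewrite flat_rcons cat_uniq /= !inE !negb_or !andbT; case: (uniq _) => //=.
by rewrite -!andbA.
Qed.

(** Send [p.1] to [q.1], then the image [y] of [p.2] to [q.2]; neither transposition moves a vertex
    of [h]. Hence sums over all relabellings do not depend on the last pair. *)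
Lemma relabel_last h p q : uniq (flat (rcons h p)) -> uniq (flat (rcons h q)) ->
  exists s, hmap s (rcons h p) = rcons h q.
Proof.
rewrite !uniq_flat_rcons => /and4P[_ p1 p2 p12] /and4P[_ q1 q2 q12].
pose y := tperm p.1 q.1 p.2.
have yV : y \in rest h by rewrite /y; case: tpermP => // ->.
have yq : y != q.1.
  by rewrite -(tpermL p.1 q.1) /y (inj_eq perm_inj) eq_sym.
exists (tperm p.1 q.1 * tperm y q.2)%g.
rewrite /hmap map_rcons !permM tpermL tpermD // 1?eq_sym // -/y tpermL -surjective_pairing.
congr rcons; apply: hmap_id => x xh.
have out z : z \in rest h -> z != x by apply: contraTneq => ->; rewrite inE negbK.
by rewrite permM !tpermD ?out.
Qed.

Lemma perm_imset_sub s A B : (s @: A \subset s @: B) = (A \subset B).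
Proof.
apply/idP/idP => [/subsetP sAB|]; last exact: imsetS.
apply/subsetP => x xA; rewrite -(mem_imset _ _ (@perm_inj _ s)) sAB //.
by rewrite mem_imset //; exact: perm_inj.
Qed.

Lemma perm_imsetD1 s A x : s @: (A :\ x) = s @: A :\ s x.
Proof.
apply/setP => y; rewrite -[y](permKV s) inE !mem_imset; try exact: perm_inj.
by rewrite !inE (inj_eq perm_inj).
Qed.

Lemma wsum_imset s k V w : wsum k (s @: V) w = wsum k V (pull w s).
Proof.
rewrite /wsum (reindex_inj (imset_inj (@perm_inj _ s))) /=; apply: eq_bigl => e.
by rewrite perm_imset_sub card_imset //; exact: perm_inj.
Qed.

Lemma Wvec0 k V w : Wvec k V w 0 = `|wsum k V w| / ('C(#|V|, k))%:R.
Proof. by case: k. Qed.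

Lemma WvecS k V w i : Wvec k.+1 V w i.+1 = (#|V| * (#|V|).-1)%:R^-1 *
      \sum_(x in V) \sum_(y in V | y != x) Wvec k (V :\ x :\ y) (diffw w x y) i.
Proof. by []. Qed.

Lemma Wvec_imset s k V w i : Wvec k (s @: V) w i = Wvec k V (pull w s) i.
Proof.
elim: i k V w => [|i IH] k V w.
  by rewrite !Wvec0 wsum_imset card_imset //; exact: perm_inj.
case: k => [|k] //; rewrite !WvecS card_imset; last exact: perm_inj.
congr (_ * _); rewrite (reindex_inj (@perm_inj _ s)) /=.
apply: eq_big => x; rewrite ?mem_imset //; try exact: perm_inj.
move=> _; rewrite (reindex_inj (@perm_inj _ s)) /=.
apply: eq_big => y; rewrite ?mem_imset ?(inj_eq perm_inj) //; try exact: perm_inj.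
by move=> _; rewrite diffw_pull -IH !perm_imsetD1.
Qed.

Lemma Wvec_ge0 k V w i : 0 <= Wvec k V w i.
Proof.
elim: i k V w => [|i IH] k V w; first by rewrite Wvec0 divr_ge0.
case: k => [|k] //; rewrite WvecS mulr_ge0 ?invr_ge0 //.
by apply: sumr_ge0 => x _; apply: sumr_ge0 => y _; exact: IH.
Qed.

(** After [i] differences fewer than [k - i] vertices remain: the binomial coefficient vanishes, and
    division by zero yields zero. *)
Lemma Wvec_small k V w i : (#|V| < k + i)%N -> Wvec k V w i = 0.
Proof.
elim: i k V w => [|i IH] k V w; first by rewrite addn0 Wvec0 => /bin_small ->; rewrite invr0 mulr0.
case: k => [|k] // cV; rewrite WvecS big1 ?mulr0 // => x xV; rewrite big1 // => y /andP[yV yx].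
apply: IH; have := cardsD1 x V; have := cardsD1 y (V :\ x).
rewrite xV !inE yx yV /= => -> V2; move: cV; rewrite V2 !add1n addSn addnS !ltnS; exact: leq_trans.
Qed.

Lemma sum_Wvec_last h p q k w i : uniq (flat (rcons h p)) -> uniq (flat (rcons h q)) ->
  \sum_s Wvec k (rest (rcons h p)) (diffs (rcons h p) (pull w s)) i =
  \sum_s Wvec k (rest (rcons h q)) (diffs (rcons h q) (pull w s)) i.
Proof.
move=> up uq; have [t <-] := relabel_last up uq.
rewrite (reindex_inj (mulgI t)) /=; apply: eq_bigr => s _.
by rewrite rest_hmap Wvec_imset -diffs_pull pullM.
Qed.

(** Once summed over relabellings, all ordered pairs [(x, y)] contribute equally, so the average
    defining the W-vector reduces to the single pair [p]. *)
Lemma sum_Wvec_rcons h p k w i : uniq (flat (rcons h p)) ->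
  \sum_s Wvec k.+1 (rest h) (diffs h (pull w s)) i.+1 =
  \sum_s Wvec k (rest (rcons h p)) (diffs (rcons h p) (pull w s)) i.
Proof.
move=> up; have := up; rewrite uniq_flat_rcons => /and4P[uh p1 p2 p12].
under eq_bigr do rewrite WvecS.
rewrite -mulr_sumr exchange_big /=.
set G := RHS; have E x : x \in rest h ->
    \sum_s \sum_(y in rest h | y != x) Wvec k (rest h :\ x :\ y) (diffw (diffs h (pull w s)) x y)
      i =
    (#|rest h|.-1)%:R * G.
  move=> xV; rewrite exchange_big /=; transitivity (\sum_(y in rest h | y != x) G).
    apply: eq_bigr => y /andP[yV yx]; rewrite /G -(@sum_Wvec_last h (x, y)) //.
      by apply: eq_bigr => s _; rewrite rest_rcons diffs_rcons.
    by rewrite uniq_flat_rcons uh xV yV eq_sym.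
  rewrite sumr_const (cardsD1 x) xV -[LHS]mulr_natl; congr (_%:R * _).
  by rewrite add1n; apply: eq_card => y; rewrite unfold_in !inE andbC.
rewrite (eq_bigr _ E) sumr_const -[X in _ * X]mulr_natl [X in _ * X]mulrA -natrM mulrA mulVf
  ?mul1r // pnatr_eq0.
by rewrite (cardsD1 p.1) p1 (cardsD1 p.2) in_setD1 p2 (eq_sym p.2) p12.
Qed.

Lemma sum_Wvec h h' k w i : size h' = i -> uniq (flat (h ++ h')) -> (i <= k)%N ->
  \sum_s Wvec k (rest h) (diffs h (pull w s)) i =
  \sum_s `|wsum (k - i) (rest (h ++ h')) (diffs (h ++ h') (pull w s))| /
    ('C(#|rest (h ++ h')|, k - i))%:R.
Proof.
elim: i h h' k => [|i IH] h [|p h'] // k.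
  by rewrite cats0 subn0 => _ _ _; apply: eq_bigr => s _; rewrite Wvec0.
case: k => [|k] //= [sh]; rewrite -cat_rcons => uh; rewrite ltnS => ik.
rewrite (@sum_Wvec_rcons _ p) ?subSS; first exact: IH.
by move: uh; rewrite flat_cat cat_uniq => /and3P[].
Qed.

End Relabel.

(** * Pairings of iterated differences *)

Section Pairing.
Variables (R : realType) (T : finType).
Implicit Types (l h : seq (T * T)) (p q : T * T) (w u phi gam : {set T} -> R)
  (V A B e : {set T}) (s t pi rho : {perm T}).

Definition pair_sum V k phi gam : R := wsum k V (fun e => phi e * gam e).

Definition diff_pair h k w u := pair_sum (rest h) k (diffs h w) (diffs h u).

(** The mean absolute pairing after the differences along [h], left unnormalised: it carries a
    factor [#|{perm T}|^2]. *)
Definition diff_total h k w u : R :=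
  \sum_pi \sum_rho `|diff_pair h k (pull w pi) (pull u rho)|.

Lemma diff_total_ge0 h k w u : 0 <= diff_total h k w u.
Proof. by apply: sumr_ge0 => ? _; apply: sumr_ge0. Qed.

Lemma diff_pair_hmap s h k w u :
  diff_pair (hmap s h) k w u = diff_pair h k (pull w s) (pull u s).
Proof. by rewrite /diff_pair /pair_sum rest_hmap wsum_imset !diffs_pull. Qed.

Lemma diff_total_last h p q k w u : uniq (flat (rcons h p)) -> uniq (flat (rcons h q)) ->
  diff_total (rcons h p) k w u = diff_total (rcons h q) k w u.
Proof.
move=> up uq; have [t <-] := relabel_last up uq.
rewrite /diff_total (reindex_inj (mulgI t)) /=; apply: eq_bigr => pi _.
rewrite (reindex_inj (mulgI t)) /=; apply: eq_bigr => rho _.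
by rewrite diff_pair_hmap !pullM.
Qed.

(** Only the sets containing exactly one of [x], [y] change. Each [e] avoiding both gives two of
    them, [x |: e] and [y |: e], and their four products factor into a product of differences. *)
Lemma pair_sum_swap V k x y phi gam : x \in V -> y \in V -> x != y ->
  pair_sum V k.+1 phi gam - pair_sum V k.+1 (pull phi (tperm x y)) gam =
  pair_sum (V :\ x :\ y) k (diffw phi x y) (diffw gam x y).
Proof.
move=> xV yV xy; rewrite /pair_sum /wsum -sumrB.
have tfix e : (x \in e) = (y \in e) -> tperm x y @: e = e.
  move=> exy; apply/setP => z; rewrite -[z](tpermK x y) mem_imset; last exact: perm_inj.
  by rewrite tpermK; case: tpermP => // ->.
rewrite (bigID (fun e => (x \in e) == (y \in e))) /= big1 ?add0r; last first.
  by move=> e /andP[_ /eqP exy]; rewrite /pull tfix // subrr.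
rewrite (bigID (fun e => x \in e)) /=.
pose W := V :\ x :\ y.
have half a b (G : {set T} -> R) : a \in V -> b \in V -> a != b -> W = V :\ a :\ b ->
    \sum_(e : {set T} | ((e \subset V) && (#|e| == k.+1)) && ((a \in e) && (b \notin e))) G e =
    \sum_(e : {set T} | (e \subset W) && (#|e| == k)) G (a |: e).
  move=> aV bV ab ->; rewrite (reindex_onto (fun e => a |: e) (fun e => e :\ a)) /=; last first.
    by move=> e /andP[_ /andP[ae _]]; rewrite setD1K.
  apply: eq_bigl => e; rewrite !subsetD1 subUset sub1set aV setU11 !inE /=.
  rewrite negb_or (eq_sym b a) ab /=.
  have [ae|ae] := boolP (a \in e).
    have -> : ((a |: e) :\ a == e) = false.
      by apply/negP => /eqP E; move: ae; rewrite -E !inE eqxx.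
    by rewrite !andbF.
  by rewrite cardsU1 ae eqSS setU1K // eqxx !andbT -!andbA; congr (_ && _); rewrite andbC.
pose F e := phi e * gam e - pull phi (tperm x y) e * gam e.
have halfx := half x y F xV yV xy (erefl _).
have halfy : _ -> _ := half y x F yV xV _.
rewrite [X in X + _ = _](_ : _ =
  \sum_(e : {set T} | ((e \subset V) && (#|e| == k.+1)) && ((x \in e) && (y \notin e))) F e);
    last first.
  by apply: eq_bigl => e; case: (x \in e); case: (y \in e); rewrite ?andbF ?andbT.
rewrite [X in _ + X = _](_ : _ =
  \sum_(e : {set T} | ((e \subset V) && (#|e| == k.+1)) && ((y \in e) && (x \notin e))) F e);
    last first.
  by apply: eq_bigl => e; case: (x \in e); case: (y \in e); rewrite ?andbF ?andbT.
rewrite halfx halfy; first last.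
- by rewrite /W setDDl setUC -setDDl.
- by rewrite eq_sym.
rewrite -big_split /=; apply: eq_bigr => e /andP[/subsetP eW _].
have xe : x \notin e by apply/negP => /eW; rewrite !inE eqxx andbF.
have ye : y \notin e by apply/negP => /eW; rewrite !inE eqxx.
rewrite /F /pull !imsetU1 tpermL tpermR tfix ?(negbTE xe) ?(negbTE ye) // /diffw; ring.
Qed.

Lemma diff_pair_swap h p k w u : uniq (flat (rcons h p)) ->
  diff_pair h k.+1 w u - diff_pair h k.+1 (pull w (swap p)) u = diff_pair (rcons h p) k w u.
Proof.
rewrite uniq_flat_rcons => /and4P[uh p1 p2 p12].
rewrite /diff_pair rest_rcons !diffs_rcons -pair_sum_swap //; congr (_ - pair_sum _ _ _ _).
rewrite diffs_pull hmap_id // => x xh; apply: swap_fix; rewrite !inE negb_or.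
by move: p1 p2; rewrite !inE => /memPn -> // /memPn ->.
Qed.

Lemma deg_le_cube h l k w u pi : uniq (flat (h ++ l)) ->
  deg_le (size l) k (cube l (fun z => diff_pair h k (pull w z) u) pi).
Proof.
rewrite flat_cat cat_uniq => /and3P[_ hl ul].
rewrite (_ : cube _ _ _ = fun s : seq bool => \sum_(e : {set T} | (e \subset rest h) && (#|e| == k))
   diffs h u e * diffs h (pull w pi) (swaps l s @: e)); last first.
  apply/funext => s; apply: eq_bigr => e _; rewrite mulrC; congr (_ * _).
  rewrite -pullM diffs_pull hmap_id // => x xh; apply: swaps_fix.
  by apply: contra hl => xl; apply/hasP; exists x.
apply: deg_le_sum => e /andP[_ /eqP ek].
apply: deg_le_leq (deg_le_swaps (fun e' => diffs h u e * diffs h (pull w pi) e') e ul).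
by rewrite -ek subset_leq_card //; apply/subsetP => x; rewrite !inE => /andP[].
Qed.

(** The cube spanned by the [m] pairs of [p :: l] has total [L^1] influence made of [m] equal
    contributions, while [infl1_le] allows only a multiple of [sqrt m]; the quotient is the gain. *)
Lemma diff_total_step h p l k w u : uniq (flat (h ++ p :: l)) ->
  (size l).+1%:R * diff_total (rcons h p) k w u ^+ 2 <=
    32 * k.+1%:R * 9 ^+ k.+1 * diff_total h k.+1 w u ^+ 2.
Proof.
move=> uh; set C := 32 * k.+1%:R * 9 ^+ k.+1; pose m := size (p :: l).
have uq q : q \in p :: l -> uniq (flat (rcons h q)).
  move=> ql; rewrite uniq_flat_rcons; move: uh; rewrite flat_cat cat_uniq => /and3P[-> hl ul] /=.
  rewrite (uniq_flat_mem ul ql) !inE andbT; have /andP[q1 q2] := mem_flat ql.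
  by apply/andP; split; apply: contra hl => xl; apply/hasP; [exists q.1|exists q.2].
have up : uniq (flat (rcons h p)) by apply: uq; rewrite inE eqxx.
have ul : uniq (flat (p :: l)) by move: uh; rewrite flat_cat cat_uniq => /and3P[].
have : m%:R * diff_total (rcons h p) k w u <= Num.sqrt (C * m%:R) * diff_total h k.+1 w u.
  pose Phi rho z := diff_pair h k.+1 (pull w z) (pull u rho).
  have -> : m%:R * diff_total (rcons h p) k w u =
      \sum_rho \sum_pi infl1 m (cube (p :: l) (Phi rho) pi).
    under eq_bigr do rewrite sum_infl1_cube //.
    rewrite exchange_big /= (_ : m%:R * _ = \sum_(q <- p :: l) diff_total (rcons h p) k w u);
      last first.
      by rewrite big_const_seq count_predT iter_addr_0 mulr_natl.
    rewrite !big_seq; apply: eq_bigr => q /uq uhq; rewrite (diff_total_last _ _ _ up uhq)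
      /diff_total.
    rewrite exchange_big /=; apply: eq_bigr => rho _; apply: eq_bigr => pi _.
    by rewrite /Phi -pullM diff_pair_swap.
  have -> : diff_total h k.+1 w u =
      \sum_rho \sum_pi Ex m (cube (p :: l) (fun z => `|Phi rho z|) pi).
    by rewrite /diff_total exchange_big; apply: eq_bigr => rho _; rewrite sum_Ex_cube.
  rewrite mulr_sumr; apply: ler_sum => rho _; rewrite mulr_sumr; apply: ler_sum => pi _.
  apply: infl1_le; exact: deg_le_cube.
have T0 := diff_total_ge0 (rcons h p) k w u; have T1 := diff_total_ge0 h k.+1 w u.
have m0 : 0 < m%:R :> R by rewrite ltr0n.
move=> hle; rewrite -[(size l).+1]/m -(@ler_pM2l _ m%:R) //.
have : (m%:R * diff_total (rcons h p) k w u) ^+ 2 <= (Num.sqrt (C * m%:R) * diff_total h k.+1 w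
  u) ^+ 2.
  by rewrite ler_pXn2r ?nnegrE ?mulr_ge0 ?sqrtr_ge0.
rewrite !exprMn sqr_sqrtr ?mulr_ge0 ?exprn_ge0 // ; lra.
Qed.

End Pairing.

(** * Averages over the symmetric group *)

Section Averages.
Variables (R : realType) (T : finType).
Implicit Types (l h : seq (T * T)) (p q : T * T) (w u phi gam : {set T} -> R)
  (V A B e : {set T}) (s t pi rho : {perm T}).

(** Induction on [#|A :\: B|]: exchange an element of [A] outside [B] with one of [B] outside
    [A]. *)
Lemma perm_on_trans V A B : A \subset V -> B \subset V -> #|A| = #|B| ->
  exists2 t, perm_on V t & t @: A = B.
Proof.
move En : #|A :\: B| => n; elim: n A En => [|n IH] A En AV BV AB.
  exists 1%g; first exact: perm_on1.
  rewrite imset_fix => [|x _]; last by rewrite perm1.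
  by apply/eqP; rewrite eqEcard AB leqnn andbT -setD_eq0 -cards_eq0 En.
have [a aAB] : exists a, a \in A :\: B by apply/card_gt0P; rewrite En.
have [b bBA] : exists b, b \in B :\: A.
  by apply/card_gt0P; rewrite cardsD setIC -AB -cardsD En.
move: (aAB) (bBA); rewrite !inE => /andP[aB aA] /andP[bA bB].
have aV := subsetP AV a aA; have bV := subsetP BV b bB.
have abV : perm_on V (tperm a b).
  by apply: subset_trans (tperm_on a b) _; rewrite subUset !sub1set aV.
have En' : #|(tperm a b @: A) :\: B| = n.
  apply/eqP; rewrite -eqSS -En (cardsD1 a (A :\: B)) aAB add1n eqSS; apply/eqP.
  apply: eq_card => x; rewrite -[x in LHS](tpermK a b) !inE mem_imset; last exact: perm_inj.
  rewrite tpermK; case: tpermP => [->|->|/eqP xa /eqP xb].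
  - by rewrite (negbTE bA) andbF eqxx.
  - by rewrite bB aA /= andbF.
  - by rewrite xa.
have AV' : tperm a b @: A \subset V by rewrite -(im_perm_on abV); exact: imsetS.
have AB' : #|tperm a b @: A| = #|B| by rewrite card_imset //; exact: perm_inj.
have [t tV tA] := IH _ En' AV' BV AB'.
exists (tperm a b * t)%g; first exact: perm_onM.
by rewrite imset_permM.
Qed.

(** By transitivity the left sum is the same for every [k]-subset of [V]; summing it over all of
    them and exchanging the sums gives the total weight for each [s]. *)
Lemma sum_perm_on V k phi e : e \subset V -> #|e| = k ->
  ('C(#|V|, k))%:R * \sum_(s | perm_on V s) phi (s @: e) = #|perm_on V|%:R * wsum k V phi.
Proof.
move=> eV ek; transitivity (\sum_(e' : {set T} | (e' \subset V) && (#|e'| == k))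
    \sum_(s | perm_on V s) phi (s @: e')).
  rewrite mulr_natl -cards_draws -sumr_const.
  apply: eq_big => e'; rewrite inE // => /andP[eV' /eqP ek'].
  have [t tV <-] := perm_on_trans eV eV' (etrans ek (esym ek')).
  rewrite (reindex_inj (mulgI t)) /=; apply: eq_big => s.
    apply/idP/idP => [ts|]; last exact: perm_onM.
    by rewrite -(mulKg t s) perm_onM // perm_onV.
  by rewrite imset_permM.
rewrite exchange_big /= mulr_natl -sumr_const; apply: eq_bigr => s sV.
by rewrite -[V in RHS](im_perm_on sV) wsum_imset.
Qed.

Lemma sum_pair_sum V k phi gam :
  ('C(#|V|, k))%:R * \sum_(s | perm_on V s) pair_sum V k (pull phi s) gam =
  #|perm_on V|%:R * (wsum k V phi * wsum k V gam).
Proof.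
rewrite exchange_big /= mulr_sumr mulrA [in RHS]mulr_sumr; apply: eq_bigr => e /andP[eV /eqP ek].
by rewrite -mulr_suml mulrA sum_perm_on.
Qed.

Lemma card_perm_on_gt0 V : 0 < #|perm_on V|%:R :> R.
Proof. by rewrite ltr0n; apply/card_gt0P; exists 1%g; exact: perm_on1. Qed.

Lemma sum_diff_pair k w u :
  ('C(#|T|, k))%:R * \sum_pi \sum_rho diff_pair [::] k (pull w pi) (pull u rho) =
  #|{perm T}|%:R ^+ 2 * (wsum k setT w * wsum k setT u).
Proof.
have rT : rest [::] = [set: T] by apply/setP => x; rewrite !inE.
have pT s : perm_on [set: T] s by apply/subsetP => x _; rewrite inE.
have cT : #|perm_on [set: T]| = #|{perm T}|.
  by apply: eq_card => s; rewrite !inE; exact: pT.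
rewrite exchange_big mulr_sumr expr2 -mulrA -[in LHS]cardsT -cT.
under eq_bigr => rho _.
  rewrite (eq_bigl (perm_on [set: T])); last by move=> s; rewrite pT.
  rewrite /diff_pair /= rT sum_pair_sum.
  rewrite -wsum_imset (im_perm_on (pT rho)); over.
by rewrite /= sumr_const -[LHS]mulr_natl cT.
Qed.

(** Permuting the vertices of [rest h] once more leaves [diff_total] unchanged. Taking this average
    inside the absolute value turns the pairing into a product of total weights. *)
Lemma diff_total_lower h k w u : (k <= #|rest h|)%N ->
  (\sum_pi `|wsum k (rest h) (diffs h (pull w pi))|) *
  (\sum_rho `|wsum k (rest h) (diffs h (pull u rho))|) <=
  ('C(#|rest h|, k))%:R * diff_total h k w u.
Proof.
move=> kV; set V := rest h; set g : R := #|perm_on V|%:R.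
have g0 : 0 < g by exact: card_perm_on_gt0.
rewrite -(@ler_pM2l _ g) //; set c := _%:R.
have -> : g * (c * diff_total h k w u) =
  c * \sum_pi \sum_rho \sum_(s | perm_on V s) `|pair_sum V k (pull (diffs h (pull w pi)) s)
    (diffs h (pull u rho))|.
  rewrite mulrCA; congr (c * _); rewrite /g mulr_natl -sumr_const.
  under [RHS]eq_bigr do rewrite exchange_big.
  rewrite [RHS]exchange_big /=; apply: eq_bigr => s sV.
  rewrite /diff_total (reindex_inj (mulgI s)) /=; apply: eq_bigr => pi _; apply: eq_bigr => rho _.
  congr `|_|; rewrite -pullM /diff_pair diffs_pull hmap_id // => x xh.
  by apply: (out_perm sV); rewrite inE negbK.
rewrite mulr_suml !mulr_sumr; apply: ler_sum => pi _.
rewrite !mulr_sumr; apply: ler_sum => rho _.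
rewrite -[in leLHS](ger0_norm (ltW g0)) -!normrM mulrA -mulrA -sum_pair_sum normrM.
by rewrite ger0_norm ?ler_wpM2l // ler_norm_sum.
Qed.

Lemma diffsN h w : diffs h (fun e => - w e) = fun e => - diffs h w e.
Proof.
elim: h w => //= p h IH w; rewrite -IH; congr (diffs h _).
by apply/funext => e; rewrite /diffw opprD.
Qed.

Lemma diff_pairN h k w u : diff_pair h k (fun e => - w e) u = - diff_pair h k w u.
Proof.
rewrite /diff_pair diffsN /pair_sum /wsum -sumrN.
by apply: eq_bigr => e _; rewrite mulNr.
Qed.

Lemma diff_totalN h k w u : diff_total h k (fun e => - w e) u = diff_total h k w u.
Proof.
apply: eq_bigr => pi _; apply: eq_bigr => rho _.
by rewrite -[pull _ pi]/(fun e => - pull w pi e) diff_pairN normrN.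
Qed.

(** The increments sum to zero, so their positive parts make up half of the absolute values. *)
Lemma sum_pos_part p (Phi : {perm T} -> R) :
  \sum_pi (Phi pi < Phi (swap p * pi)%g)%R%:R * (Phi (swap p * pi)%g - Phi pi) =
  (\sum_pi `|Phi pi - Phi (swap p * pi)%g|) / 2.
Proof.
have E : \sum_pi (Phi (swap p * pi)%g - Phi pi) = 0.
  by rewrite sumrB [X in _ - X](reindex_inj (mulgI (swap p))) subrr.
rewrite -[X in X / 2]addr0 -[X in (_ + X) / 2]E -big_split mulr_suml.
apply: eq_bigr => pi _ /=; case: ltrP => _; rewrite ?mul1r ?mul0r; by field.
Qed.

(** The polynomial estimate is a hypothesis, so that one constant [C] serves both [w] and [- w]. *)
Lemma swap_step (k : nat) (C : R) l w u (lo hi mu : R) :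
  (forall (q : {poly R}) (lo hi : R), (size q <= k.+2)%N -> (forall t : R, 0 <= t <= 1 -> lo <=
    q.[t] <= hi) ->
    0 <= q`_1 -> q`_1 ^+ 2 <= C * ((hi - q`_0) * (hi - lo))) ->
  uniq (flat l) ->
  (forall pi rho, lo <= diff_pair [::] k.+1 (pull w pi) (pull u rho) <= hi) ->
  \sum_pi \sum_rho diff_pair [::] k.+1 (pull w pi) (pull u rho) = #|{perm T}|%:R ^+ 2 * mu ->
  (\sum_(p <- l) diff_total [:: p] k w u) ^+ 2 <=
    4 * C * #|{perm T}|%:R ^+ 4 * ((hi - mu) * (hi - lo)).
Proof.
set K : R := #|{perm T}|%:R => hC ul hb hmu.
pose Phi rho pi := diff_pair [::] k.+1 (pull w pi) (pull u rho).
pose c rho pi p := Phi rho pi < Phi rho (swap p * pi)%g.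
(* The flags depend on [pi] and [rho] only, not on the point of the cube, so the degree stays at
   most [k.+1]. *)
pose q := \sum_rho \sum_pi bias [seq c rho pi p | p <- l] (cube l (Phi rho) pi).
have q0 : q`_0 = K ^+ 2 * mu.
  rewrite -hmu exchange_big coef_sum; apply: eq_bigr => rho _; rewrite coef_sum.
  by apply: eq_bigr => pi _; rewrite bias_cube0.
have q1 : q`_1 = (\sum_(p <- l) diff_total [:: p] k w u) / 2.
  transitivity (\sum_rho \sum_pi \sum_(p <- l)
      (c rho pi p)%:R * (Phi rho (swap p * pi)%g - Phi rho pi)).
    rewrite coef_sum; apply: eq_bigr => rho _; rewrite coef_sum.
    by apply: eq_bigr => pi _; rewrite bias_cube1.
  under eq_bigr do rewrite exchange_big /=.
  rewrite exchange_big /= mulr_suml !big_seq; apply: eq_bigr => p pl.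
  under eq_bigr do rewrite sum_pos_part.
  rewrite -mulr_suml /diff_total exchange_big /=; congr (_ / _).
  apply: eq_bigr => rho _; apply: eq_bigr => pi _; congr `|_|.
  rewrite /Phi -pullM (@diff_pair_swap _ _ [::] p) //=.
  by rewrite inE (uniq_flat_mem ul pl).
have KK (x : R) : K ^+ 2 * x = \sum_(rho : {perm T}) \sum_(pi : {perm T}) x.
  by rewrite /K expr2 -mulrA !sumr_const !mulr_natl.
have := hC q (K ^+ 2 * lo) (K ^+ 2 * hi); rewrite q1 q0.
move=> h.
suff : ((\sum_(p <- l) diff_total [:: p] k w u) / 2) ^+ 2 <=
  C * ((K ^+ 2 * hi - K ^+ 2 * mu) * (K ^+ 2 * hi - K ^+ 2 * lo)) by lra.
apply: h.
- apply: (leq_trans (size_sum _ _ _)); apply/bigmax_leqP => rho _.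
  apply: (leq_trans (size_sum _ _ _)); apply/bigmax_leqP => pi _.
  apply: size_bias; rewrite size_map; exact: (@deg_le_cube _ _ [::]).
- move=> t t01; rewrite !KK horner_sum; apply/andP; split; apply: ler_sum => rho _;
    rewrite horner_sum; apply: ler_sum => pi _.
    by have /andP[] := bias_bound [seq c rho pi p | p <- l] (fun s : seq bool => hb (swaps l s *
      pi)%g rho) t01.
  by have /andP[] := bias_bound [seq c rho pi p | p <- l] (fun s : seq bool => hb (swaps l s *
    pi)%g rho) t01.
- by rewrite divr_ge0 // sumr_ge0 // => p _; exact: diff_total_ge0.
Qed.

(** At each of the [r] steps at least [M] pairs are still available, and [K] bounds all the degrees,
    so every step has the same gain and the same constant. *)
Lemma diff_total_chain K h l r k w u M : uniq (flat (h ++ l)) -> (k + r <= K)%N ->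
  (0 < M)%N -> (M + r <= (size l).+1)%N ->
  M%:R ^+ r * diff_total (h ++ take r l) k w u ^+ 2 <=
    (32 * K%:R * 9 ^+ K) ^+ r * diff_total h (k + r) w u ^+ 2.
Proof.
move=> + + M0; elim: r h l => [|r IH] h l uh kK Ml; first by rewrite take0 cats0 addn0.
case: l uh Ml => [|p l] uh Ml; first by move: Ml; rewrite addnS ltnS leqn0 addn_eq0 -leqn0 leqNgt
  M0.
rewrite /= -cat_rcons addnS.
have := IH (rcons h p) l; rewrite cat_rcons => /(_ uh).
rewrite (leq_trans _ kK) ?leq_add2l // => /(_ isT).
rewrite addnS ltnS in Ml; move=> /(_ Ml) ih.
have st := diff_total_step (k + r) w u uh.
set a := 32 * _ * _ in ih *; have a0 : 0 <= a by rewrite mulr_ge0 ?exprn_ge0 // mulr_ge0.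
rewrite (exprS _ r) (exprS _ r) -[leLHS]mulrA -[leRHS]mulrA.
apply: le_trans (ler_wpM2l (ler0n _ _) ih) _.
rewrite mulrCA [leRHS]mulrCA ler_wpM2l ?exprn_ge0 //.
have T0 := sqr_ge0 (diff_total (rcons h p) (k + r) w u).
have T1 := sqr_ge0 (diff_total h (k + r).+1 w u).
apply: le_trans (ler_wpM2r T0 _) (le_trans st (ler_wpM2r T1 _)).
  by rewrite ler_nat (leq_trans _ Ml) // leq_addr.
rewrite addnS in kK.
rewrite /a ler_pM ?mulr_ge0 ?exprn_ge0 // ?ler_wpM2l ?ler_nat // ler_eXn2l //.
by rewrite (ltr_nat _ 1 9).
Qed.

End Averages.

(** * Discrepancies *)

Section Discrepancy.
Variable R : realType.

Fixpoint pairup (T : Type) (s : seq T) : seq (T * T) :=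
  if s is x :: y :: s' then (x, y) :: pairup s' else [::].

Lemma size_pairup (T : Type) (s : seq T) : size (pairup s) = (size s)./2.
Proof.
suff : size (pairup s) = (size s)./2 /\ forall x, size (pairup (x :: s)) = (size (x :: s))./2.
  by case.
elim: s => [|y s [IH1 IH2]]; split => // x.
by rewrite /= IH1.
Qed.

Lemma subseq_pairup (T : finType) (s : seq T) : subseq (flat (pairup s)) s.
Proof.
suff : subseq (flat (pairup s)) s /\ forall x, subseq (flat (pairup (x :: s))) (x :: s).
  by case.
elim: s => [|y s [IH1 IH2]]; split => // x.
by rewrite /= flat_cons /= !eqxx.
Qed.

Variables (n : nat) (k : nat).
Implicit Types w u : {set 'I_n} -> R.

(** Relabelling both hypergraphs by [rho^-1] shows that only [rho^-1 * pi] matters. *)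
Lemma diff_pair_inner w u (pi rho : {perm 'I_n}) :
  diff_pair [::] k (pull w pi) (pull u rho) = inner k (wperm w (rho^-1 * pi)^-1%g) u.
Proof.
have -> : wperm w (rho^-1 * pi)^-1%g = pull (pull w pi) rho^-1%g.
  by rewrite pullM; apply/funext => e; rewrite /wperm invgK.
rewrite /diff_pair /= /pair_sum /wsum /inner.
rewrite (reindex_inj (imset_inj (@perm_inj _ rho^-1%g))) /=; apply: eq_big => e.
  rewrite card_imset; last exact: perm_inj.
  by rewrite (_ : _ \subset _) //; apply/subsetP => x; rewrite inE.
move=> _; rewrite -/(pull (pull u rho) rho^-1%g e) pullM mulVg; congr (_ * u _).
by apply: imset_fix => x _; rewrite perm1.
Qed.

Lemma maxperm_ge w u pi : inner k (wperm w pi) u <= maxperm k w u.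
Proof. exact: (le_bigmax _ (fun p => inner k (wperm w p) u)). Qed.

Lemma minperm_le w u pi : minperm k w u <= inner k (wperm w pi) u.
Proof. exact: (bigmin_le _ pi (fun p => inner k (wperm w p) u)). Qed.

Lemma mean_diff_pair w u : (k <= n)%N ->
  \sum_(pi : {perm 'I_n}) \sum_(rho : {perm 'I_n}) diff_pair [::] k (pull w pi) (pull u rho) =
  #|{perm 'I_n}|%:R ^+ 2 * (dens k w * dens k u * ('C(n, k))%:R).
Proof.
move=> kn; have c0 : ('C(n, k))%:R != 0 :> R by rewrite pnatr_eq0 -lt0n bin_gt0.
apply: (mulfI c0); have := sum_diff_pair k w u; rewrite card_ord => ->.
by rewrite /dens; field.
Qed.

Lemma card_permR_gt0 : 0 < #|{perm 'I_n}|%:R :> R.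
Proof. by rewrite ltr0n; apply/card_gt0P; exists 1%g. Qed.

Lemma discP_ge0 w u : (k <= n)%N -> 0 <= discP k w u.
Proof.
move=> kn; rewrite subr_ge0; set mu := _ * _; set K : R := #|{perm 'I_n}|%:R.
have K0 : 0 < K ^+ 2 by rewrite exprn_gt0 // card_permR_gt0.
rewrite -(ler_pM2l K0) -mean_diff_pair //.
rewrite expr2 -mulrA mulr_natl -sumr_const; apply: ler_sum => pi _.
rewrite mulr_natl -sumr_const; apply: ler_sum => rho _.
by rewrite diff_pair_inner maxperm_ge.
Qed.

Lemma discM_ge0 w u : (k <= n)%N -> 0 <= discM k w u.
Proof.
move=> kn; rewrite subr_ge0; set mu := _ * _; set K : R := #|{perm 'I_n}|%:R.
have K0 : 0 < K ^+ 2 by rewrite exprn_gt0 // card_permR_gt0.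
rewrite -(ler_pM2l K0) -mean_diff_pair //.
rewrite expr2 -mulrA mulr_natl -sumr_const; apply: ler_sum => pi _.
rewrite mulr_natl -sumr_const; apply: ler_sum => rho _.
by rewrite diff_pair_inner minperm_le.
Qed.

End Discrepancy.

Lemma disc_swap_bound (R : realType) (k : nat) : exists2 C : R, 0 <= C &
  forall n (w u : {set 'I_n} -> R) (l : seq ('I_n * 'I_n)), (k.+1 <= n)%N -> uniq (flat l) ->
  (\sum_(p <- l) diff_total [:: p] k w u) ^+ 2 <=
    C * #|{perm 'I_n}|%:R ^+ 4 * (discP k.+1 w u * discM k.+1 w u).
Proof.
have [C C0 hC] := coef1_bound R k.+1; exists (8 * C); first by rewrite mulr_ge0.
move=> n w u l kn ul; set K : R := #|{perm 'I_n}|%:R.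
have P0 := discP_ge0 w u kn; have M0 := discM_ge0 w u kn.
pose mu := dens k.+1 w * dens k.+1 u * ('C(n, k.+1))%:R.
have hb (pi rho : {perm 'I_n}) : minperm k.+1 w u <= diff_pair [::] k.+1 (pull w pi) (pull u rho)
  <= maxperm k.+1 w u.
  by rewrite diff_pair_inner minperm_le maxperm_ge.
have h1 := swap_step hC ul hb (mean_diff_pair w u kn).
(* The same bound for [- w]: the mean changes sign, and the extremes change sign and trade
   places. *)
have h2 : (\sum_(p <- l) diff_total [:: p] k w u) ^+ 2 <=
    4 * C * K ^+ 4 * ((- minperm k.+1 w u - - mu) * (- minperm k.+1 w u - - maxperm k.+1 w u)).
  rewrite (eq_bigr (fun p => diff_total [:: p] k (fun e => - w e) u)); last first.
    by move=> p _; rewrite diff_totalN.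
  apply: swap_step => //.
    by move=> pi rho; rewrite -[pull _ pi]/(fun e => - pull w pi e) diff_pairN !lerN2 andbC.
  rewrite mulrN -mean_diff_pair // -sumrN; apply: eq_bigr => pi _; rewrite -sumrN.
  by apply: eq_bigr => rho _; rewrite -[pull _ pi]/(fun e => - pull w pi e) diff_pairN.
set X := _ ^+ 2 in h1 h2 *; rewrite -/K -/mu in h1.
have E1 : maxperm k.+1 w u - mu = discP k.+1 w u by [].
have E2 : mu - minperm k.+1 w u = discM k.+1 w u by [].
have A0 : 0 <= 4 * C * K ^+ 4 by rewrite !mulr_ge0 // exprn_ge0.
rewrite (_ : maxperm k.+1 w u - minperm k.+1 w u = discP k.+1 w u + discM k.+1 w u) in h1; last
  first.
  by rewrite -E1 -E2; ring.
rewrite (_ : (_ - - _) * _ = discM k.+1 w u * (discP k.+1 w u + discM k.+1 w u)) in h2; last first.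
  by rewrite -E1 -E2; ring.
rewrite E1 in h1; move: P0 M0 h1 h2; set P := discP _ _ _; set M := discM _ _ _ => P0 M0 h1 h2.
have -> : 8 * C * K ^+ 4 * (P * M) = 4 * C * K ^+ 4 * (P * M + P * M) by ring.
(* Both [P (P + M)] and [M (P + M)] are available; the smaller is at most [2 P M], which doubles the
   constant. *)
have [PM|MP] := lerP P M.
  by apply: le_trans h1 _; rewrite ler_wpM2l // mulrDr; have := ler_wpM2l P0 PM; lra.
by apply: le_trans h2 _; rewrite ler_wpM2l // mulrDr; have := ler_wpM2l M0 (ltW MP); lra.
Qed.

(** * Bounds for the single entries of the W-vectors *)

Lemma leq_exp_ffact (n N c t : nat) : (forall j, (j < t)%N -> (n <= c * (N - j))%N) ->
  (n ^ t <= c ^ t * N ^_ t)%N.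
Proof.
elim: t => // t IH h; rewrite !expnSr ffactnSr mulnACA leq_mul ?h //.
by apply: IH => j jt; apply: h; rewrite ltnS ltnW.
Qed.

(** Each factor of the falling factorial is at least [n / (2 k)]: with [s = n - k - i] it is at
    least [s + 1], while [n <= s + 2 k]. *)
Lemma leq_exp_bin (n k i : nat) : (0 < i <= k)%N -> (k + i <= n)%N ->
  (n ^ (k - i) <= (2 * k) ^ (k - i) * (k - i)`! * 'C(n - 2 * i, k - i))%N.
Proof.
move=> /andP[i0 ik] kn; rewrite -mulnA [(_`! * _)%N]mulnC bin_ffact.
apply: leq_exp_ffact => j jk.
have -> : n = ((n - k - i) + k + i)%N by lia.
set s := (n - k - i)%N; have -> : (s + k + i - 2 * i - j = s + 1 + (k - i - j.+1))%N by lia.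
apply: (@leq_trans (2 * k * (s + 1))); last by rewrite leq_mul // leq_addr.
by rewrite mulnDr muln1; have : (1 * s <= 2 * k * s)%N; [rewrite leq_mul //; lia | lia].
Qed.

Lemma sum_wsum (R : realType) n k i (w : {set 'I_n} -> R) h :
  uniq (flat h) -> size h = i -> (i <= k)%N -> (k + i <= n)%N ->
  \sum_pi `|wsum (k - i) (rest h) (diffs h (pull w pi))| =
  ('C(n - 2 * i, k - i))%:R * #|{perm 'I_n}|%:R * Wvec k [set: 'I_n] w i.
Proof.
move=> uh sh ik kn; have cr : #|rest h| = (n - 2 * i)%N by rewrite card_rest // card_ord sh.
have c0 : ('C(n - 2 * i, k - i))%:R != 0 :> R by rewrite pnatr_eq0 -lt0n bin_gt0; lia.
have := @sum_Wvec R _ [::] h k w i sh uh ik; rewrite /= -mulr_suml cr => E.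
rewrite -[LHS](mulfVK c0) -E mulrC -mulrA; congr (_ * _).
rewrite mulr_natl -sumr_const; apply: eq_bigr => pi _.
have -> : rest [::] = [set: 'I_n] by apply/setP => x; rewrite !inE.
by rewrite -Wvec_imset; congr (Wvec k _ w i); apply/setP => x; rewrite -[x](permKV pi) mem_imset
  ?inE //; exact: perm_inj.
Qed.

(** In order: the number of pairs in the first step, the pairs left in the [i - 1] further steps,
    the binomial coefficients, and the constants of the first and of the further steps. *)
Definition level_const (R : realType) (C : R) (k i : nat) : R :=
  9 * (3 * k%:R) ^+ i.-1 * ((2 * k) ^ (k - i) * (k - i)`!)%:R ^+ 2 *
  (C * (32 * k%:R * 9 ^+ k) ^+ i.-1).

Lemma level_bound (R : realType) (C : R) (k i n : nat) (w u : {set 'I_n} -> R) : 0 <= C ->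
  (forall l : seq ('I_n * 'I_n), uniq (flat l) ->
    (\sum_(p <- l) diff_total [:: p] k.-1 w u) ^+ 2 <=
      C * #|{perm 'I_n}|%:R ^+ 4 * (discP k w u * discM k w u)) ->
  (0 < i <= k)%N -> (k <= n)%N ->
  n%:R ^+ (2 * k + 1 - i) * Wvec k [set: 'I_n] w i ^+ 2 * Wvec k [set: 'I_n] u i ^+ 2 <=
  level_const C k i * (discP k w u * discM k w u).
Proof.
case: i => [|r] // C0 hC ik kn; set W := Wvec _ _ w _; set U := Wvec _ _ u _.
set PM := discP _ _ _ * _ in hC *.
have PM0 : 0 <= PM by rewrite mulr_ge0 ?discP_ge0 ?discM_ge0.
rewrite /level_const; set B : R := _%:R ^+ 2; set A : R := (32 * _ * _).
have A0 : 0 <= A by rewrite mulr_ge0 ?exprn_ge0 // mulr_ge0.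
have B0 : 0 <= B by exact: sqr_ge0.
(* For few vertices the entry vanishes; otherwise there is room for [r.+1] disjoint pairs and a
   nonzero binomial coefficient. *)
have [nki|kin] := ltnP n (k + r.+1).
  rewrite /W Wvec_small ?cardsT ?card_ord // expr0n mulr0 mul0r.
  by apply: (mulr_ge0 _ PM0); repeat first [apply: mulr_ge0 | apply: exprn_ge0].
move: ik => /= ik.
pose L := pairup (enum 'I_n); pose m := n./2.
have sL : size L = m by rewrite size_pairup size_enum_ord.
have uL : uniq (flat L) by apply: subseq_uniq (subseq_pairup _) (enum_uniq _).
have {hC} := hC L uL.
have im : (r.+1 <= m)%N by rewrite /m; lia.
case EL : L sL uL => [|p l] sL uL; first by move: sL im => /= <-.
set N : R := #|{perm 'I_n}|%:R; have N0 : 0 < N by exact: card_permR_gt0.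
set T1 := diff_total [:: p] k.-1 w u.
have -> : \sum_(q <- p :: l) diff_total [:: q] k.-1 w u = m%:R * T1.
  transitivity (\sum_(q <- p :: l) T1).
    rewrite !big_seq; apply: eq_bigr => q ql; apply: (@diff_total_last _ _ [::] q p).
      by rewrite /= inE andbT (uniq_flat_mem uL ql).
    by have [p12 _ _ _] := uniq_flat_cons uL; rewrite /= inE andbT p12.
  by rewrite big_const_seq count_predT iter_addr_0 sL mulr_natl.
move=> H1.
pose h := p :: take r l.
have uh : uniq (flat h).
  by move: uL; rewrite -{1}(cat_take_drop r l) -cat_cons flat_cat cat_uniq => /and3P[].
have sh : size h = r.+1 by rewrite /= size_takel // -ltnS; move: sL im => /= <-.
pose Ti := diff_total h (k - r.+1) w u.
have H2 : (m - r)%:R ^+ r * Ti ^+ 2 <= A ^+ r * T1 ^+ 2.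
  have := @diff_total_chain R _ k [:: p] l r (k - r.+1) w u (m - r) uL.
  rewrite (_ : k - r.+1 + r = k.-1)%N; last by lia.
  by apply; move: sL => /=; lia.
have cr : #|rest h| = (n - 2 * r.+1)%N by rewrite card_rest // card_ord sh.
set c : R := ('C(n - 2 * r.+1, k - r.+1))%:R.
have c0 : 0 < c by rewrite ltr0n bin_gt0; lia.
have W0 : 0 <= W by exact: Wvec_ge0.
have U0 : 0 <= U by exact: Wvec_ge0.
have H3 : c * N ^+ 2 * W * U <= Ti.
  have := @diff_total_lower R _ h (k - r.+1) w u.
  have knr : (k - r.+1 <= n - 2 * r.+1)%N by clear -kin ik; lia.
  rewrite !(sum_wsum _ uh sh) // cr -/c -/N -/W -/U -/Ti => /(_ knr) H.
  rewrite -(@ler_pM2l _ c) //; apply: le_trans H; clearbody c N W U.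
  by rewrite le_eqVlt; apply/orP; left; apply/eqP; ring.
have H4 : n%:R <= 3 * m%:R :> R by rewrite -natrM ler_nat /m; clear -kin ik; lia.
(* The difference [(r + 1) (m - r) - m = r (m - r - 1)] is nonnegative, and [r + 1 <= k]. *)
have H5 : n%:R <= 3 * k%:R * (m - r)%:R :> R.
  rewrite -!natrM ler_nat; apply: (@leq_trans (3 * m)); first by rewrite /m; clear -kin ik; lia.
  rewrite -mulnA leq_mul2l /=; apply: (@leq_trans (r.+1 * (m - r))); last by rewrite leq_mul.
  by clear -im; clearbody m; nia.
have H6 : (n%:R ^+ (k - r.+1)) ^+ 2 <= B * c ^+ 2.
  rewrite /B -exprMn ler_pXn2r ?nnegrE ?mulr_ge0 ?exprn_ge0 ?(ltW c0) //.
  by rewrite -natrX /c -natrM ler_nat leq_exp_bin // ik.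
(* The exponent counts [2] for the first step, [r] for the further steps and [2 (k - i)] for the
   squared binomial coefficient. *)
have -> : (2 * k + 1 - r.+1 = 2 + (r + (k - r.+1) * 2))%N by clear -ik; lia.
rewrite !exprD exprM /=.
have Ti0 : 0 <= Ti by exact: diff_total_ge0.
have H3' : N ^+ 4 * (c ^+ 2 * W ^+ 2 * U ^+ 2) <= Ti ^+ 2.
  have : (c * N ^+ 2 * W * U) ^+ 2 <= Ti ^+ 2.
    by rewrite ler_pXn2r ?nnegrE ?mulr_ge0 ?exprn_ge0 ?(ltW c0) ?(ltW N0).
  by apply: le_trans; clearbody c N W U; rewrite le_eqVlt; apply/orP; left; apply/eqP; ring.
have N4 : 0 < N ^+ 4 by exact: exprn_gt0.
rewrite -(@ler_pM2l _ (N ^+ 4)) //.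
set a := 3 * k%:R in H5 *; have a0 : 0 <= a by rewrite mulr_ge0.
have H5' : n%:R ^+ r <= a ^+ r * (m - r)%:R ^+ r :> R.
  by rewrite -exprMn; apply: lerXn2r; rewrite ?nnegrE ?mulr_ge0.
have H4' : n%:R ^+ 2 <= 9 * m%:R ^+ 2 :> R.
  rewrite (_ : 9 * _ = (3 * m%:R) ^+ 2); last by ring.
  by apply: lerXn2r; rewrite ?nnegrE ?mulr_ge0.
have ar0 : 0 <= a ^+ r by exact: exprn_ge0.
have Ar0 : 0 <= A ^+ r by exact: exprn_ge0.
have Mr0 : 0 <= (m - r)%:R ^+ r :> R by exact: exprn_ge0.
have step1 : n%:R ^+ 2 * (n%:R ^+ r * (n%:R ^+ (k - r.+1)) ^+ 2) <=
    (9 * m%:R ^+ 2) * ((a ^+ r * (m - r)%:R ^+ r) * (B * c ^+ 2)).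
  by rewrite ler_pM ?mulr_ge0 ?exprn_ge0 // ler_pM ?exprn_ge0.
have WU0 : 0 <= N ^+ 4 * (W ^+ 2 * U ^+ 2) by rewrite !mulr_ge0 ?sqr_ge0 // ltW.
have P0 : 0 <= 9 * m%:R ^+ 2 * a ^+ r * B * (m - r)%:R ^+ r by rewrite !mulr_ge0 ?sqr_ge0.
have Q0 : 0 <= 9 * m%:R ^+ 2 * a ^+ r * B by rewrite !mulr_ge0 ?sqr_ge0.
have S0 : 0 <= 9 * a ^+ r * B * A ^+ r by rewrite !mulr_ge0.
move: (ler_wpM2r WU0 step1) (ler_wpM2l P0 H3') (ler_wpM2l Q0 H2) (ler_wpM2l S0 H1).
rewrite -/N; clearbody c N W U Ti T1 A B a m PM; clear; move: (n%:R ^+ r : R) (n%:R ^+ (k - r.+1)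
  : R) (n%:R : R) => x y z.
move: (a ^+ r) (A ^+ r) ((m - r)%:R ^+ r : R) => a' A' M' h1 h2 h3 h4.
have e : 9 * m%:R ^+ 2 * a' * B * (A' * T1 ^+ 2) = 9 * a' * B * A' * (m%:R * T1) ^+ 2 by ring.
by lra.
Qed.

Lemma level_const_ge0 (R : realType) (C : R) (k i : nat) : 0 <= C -> 0 <= level_const C k i.
Proof.
by move=> C0; repeat first [apply: mulr_ge0 | apply: exprn_ge0].
Qed.

Theorem theorem1p3 (R : realType) (k : nat) (hk : (1 <= k)%N) :
  exists (c c' : R), 0 < c /\ 0 < c' /\
  forall (n : nat), (k <= n)%N -> forall (w u : {set 'I_n} -> R),
    let W := Wvec k [set: 'I_n] w in
    let U := Wvec k [set: 'I_n] u in
    discP k w u * discM k w u >=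
      c * (n%:R) ^+ (2 * k + 1) *
      \sum_(1 <= i < k.+1) (n%:R ^- i) * (W i) ^+ 2 * (U i) ^+ 2
    /\
    disc k w u >=
      c' * ((n%:R) ^+ k * Num.sqrt (n%:R)) *
      \sum_(1 <= i < k.+1) (Num.sqrt (n%:R) ^- i) * W i * U i.
Proof.
case: k hk => // k hk; have [C C0 hC] := disc_swap_bound R k.
(* The summand [1] only ensures that [D] is positive. *)
pose D := 1 + \sum_(1 <= i < k.+2) level_const C k.+1 i.
have S0 : 0 <= \sum_(1 <= i < k.+2) level_const C k.+1 i.
  by apply: sumr_ge0 => i _; exact: level_const_ge0.
have D0 : 0 < D by rewrite ltr_wpDr.
have sD0 : 0 < Num.sqrt D by rewrite sqrtr_gt0.
exists D^-1, (k.+1%:R * Num.sqrt D)^-1; rewrite !invr_gt0 D0 mulr_gt0 //.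
split=> //; split=> // n kn w u; cbv zeta.
set W := Wvec k.+1 [set: 'I_n] w; set U := Wvec k.+1 [set: 'I_n] u.
have P0 := discP_ge0 w u kn; have M0 := discM_ge0 w u kn.
have n0 : 0 < n%:R :> R by rewrite ltr0n; exact: leq_trans kn.
have lev i : (0 < i <= k.+1)%N ->
    n%:R ^+ (2 * k.+1 + 1) * (n%:R ^- i * W i ^+ 2 * U i ^+ 2) <=
    level_const C k.+1 i * (discP k.+1 w u * discM k.+1 w u).
  move=> ik; have := @level_bound R C k.+1 i n w u C0 (fun l => hC n w u l kn) ik kn.
  rewrite expfB; last by lia.
  by rewrite -/W -/U !mulrA.
have first_part : D^-1 * n%:R ^+ (2 * k.+1 + 1) *
      (\sum_(1 <= i < k.+2) (n%:R ^- i) * (W i) ^+ 2 * (U i) ^+ 2) <=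
    discP k.+1 w u * discM k.+1 w u.
  rewrite -mulrA ler_pdivrMl // /D mulrDl mul1r.
  apply: ler_wpDl; first exact: mulr_ge0.
  rewrite mulr_sumr mulr_suml !big_nat; apply: ler_sum => i ik.
  by apply: lev; rewrite -ltnS.
split; first exact: first_part.
set d := disc _ _ _; have d0 : 0 <= d by rewrite le_max P0.
have PMd : discP k.+1 w u * discM k.+1 w u <= d ^+ 2.
  by rewrite expr2 ler_pM // le_max lexx ?orbT.
rewrite -mulrA ler_pdivrMl ?mulr_gt0 //.
(* The second inequality is proved term by term: each of the [k.+1] terms is at most
   [Num.sqrt D * d], compared after squaring. *)
have -> : k.+1%:R * Num.sqrt D * d = \sum_(1 <= i < k.+2) Num.sqrt D * d.
  by rewrite sumr_const_nat subn1 -mulrA mulr_natl.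
rewrite mulr_sumr !big_nat; apply: ler_sum => i ik.
have W0 : 0 <= W i by exact: Wvec_ge0.
have U0 : 0 <= U i by exact: Wvec_ge0.
have sn0 : 0 <= Num.sqrt (n%:R : R) by exact: sqrtr_ge0.
rewrite -(@ler_pXn2r _ 2) ?nnegrE //; first last.
- by rewrite mulr_ge0 // ltW.
- by repeat first [apply: mulr_ge0 | apply: exprn_ge0 | rewrite invr_ge0].
rewrite !exprMn exprVn -!exprM [(i * 2)%N]mulnC [(k.+1 * 2)%N]mulnC (exprM (Num.sqrt _))
  !sqr_sqrtr ?(ltW D0) ?(ltW n0) //.
apply: (@le_trans _ _ (D * (discP k.+1 w u * discM k.+1 w u))); last first.
  by rewrite ler_wpM2l // ltW.
move: first_part; rewrite -mulrA ler_pdivrMl // => /(le_trans _); apply.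
rewrite -(exprSr _ (2 * k.+1)) -[(_.+1)%N]addn1 ler_wpM2l ?exprn_ge0 ?(ltW n0) //.
(* One squared term is at most the whole nonnegative sum of the first inequality. *)
rewrite (bigD1_seq i) ?mem_index_iota ?iota_uniq //= lerDl.
apply: sumr_ge0 => j _; rewrite mulr_ge0 ?sqr_ge0 // mulr_ge0 ?sqr_ge0 //.
by rewrite invr_ge0 exprn_ge0 // ltW.
Qed.
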